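(* Let $N,n,m$ be positive integers, $T_{\mathrm h}>0$, $\varepsilon>0$, $A_i\in\mathbb{R}^{n\times n}$, $B_i\in\mathbb{R}^{n\times m}$ for $i\in\{1,\dots,N\}$, and $x_1^{\mathsf d},\dots,x_N^{\mathsf d}\in\mathbb{R}^n$. Suppose that for every $i\in\{1,\dots,N\}$ the pair $(A_i,B_i)$ is controllable, and that for all $i,j\in\{1,\dots,N\}$ there exists $\bar u_{ij}\in\mathbb{R}^m$ such that $A_i x_j^{\mathsf d}+B_i\bar u_{ij}=0$. With $\mathscr{G}_i$ and $P^*(x)$ as defined in the context, let $$\mathcal{M}' := \Bigl\{x=[x_1;\cdots;x_N]\in\mathbb{R}^{nN} : B_i^\top\mathscr{G}_i\Bigl(x_i-N\sum_{j=1}^N P^*_{ij}(x)x_j^{\mathsf d}\Bigr)=0,\ \ B_i^\top e^{-A_i^\top T_{\mathrm h}}\mathscr{G}_i\Bigl(x_i-N\sum_{j=1}^N P^*_{ij}(x)x_j^{\mathsf d}\Bigr)=0,\ \forall i\in\{1,\dots,N\}\Bigr\}.$$ Then, for any initial state $x(0)\in\mathbb{R}^{nN}$, the solution $x(t)=[x_1(t);\cdots;x_N(t)]$ of $$\dot x_i(t)=(A_i-B_iB_i^\top\mathscr{G}_i)\Bigl(x_i(t)-N\sum_{j=1}^N P^*_{ij}(x(t))x_j^{\mathsf d}\Bigr),\quad i\in\{1,\dots,N\},$$ converges, as $t\to\infty$, to the largest invariant set contained in $\mathcal{M}'$ for the dynamics $$\dot x_i(t)=A_i\Bigl(x_i(t)-N\sum_{j=1}^N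 P^*_{ij}(x(t))x_j^{\mathsf d}\Bigr),\quad i\in\{1,\dots,N\}.$$
   Context: $[x_1;\cdots;x_N]\in\mathbb{R}^{nN}$ denotes the stacked column vector of $x_1,\dots,x_N\in\mathbb{R}^n$. For a positive semidefinite matrix $G$, $\|v\|_G:=(v^\top G v)^{1/2}$. $\mathbf{1}_N$ is the $N$-vector of ones. For each $i$, $$\mathscr{G}_i:=\Bigl(\int_0^{T_{\mathrm h}}e^{-A_it}B_iB_i^\top e^{-A_i^\top t}\,dt\Bigr)^{-1},$$ which is well defined when $(A_i,B_i)$ is controllable. Let $\mathcal{T}(\mathbf{1}_N/N):=\{P\in\mathbb{R}_{\ge0}^{N\times N}: P\mathbf{1}_N=P^\top\mathbf{1}_N=\mathbf{1}_N/N\}$. For $x=[x_1;\cdots;x_N]\in\mathbb{R}^{nN}$, $P^*(x)=(P^*_{ij}(x))$ denotes the unique solution of the entropic optimal transport problem $$\min_{P\in\mathcal{T}(\mathbf{1}_N/N)}\ \sum_{i,j=1}^N C_{ij}P_{ij}-\varepsilon\,\mathrm{H}(P),\qquad \mathrm{H}(P):=-\sum_{i,j}P_{ij}(\log P_{ij}-1),$$ with $C_{ij}=\|x_i-x_j^{\mathsf d}\|_{\mathscr{G}_i}^2$ (convention $0\log 0=0$). A set $M$ is invariant for a dynamics if every trajectory starting in $M$ remains in $M$ for all $t\in\mathbb{R}$. The trajectory $x(t)$ converges to a set $M$ as $t\to\infty$ if $\inf_{y\in M}\|x(t)-y\|\to0$. *)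

(* Defs.v *)
From HB Require Import structures.
From mathcomp Require Import all_boot all_order all_algebra.
From mathcomp Require Import all_classical all_reals all_analysis.

Set Implicit Arguments.
Unset Strict Implicit.
Unset Printing Implicit Defensive.

Import Order.TTheory GRing.Theory Num.Theory.
Import numFieldNormedType.Exports.

Local Open Scope classical_set_scope.
Local Open Scope ring_scope.

Definition expmx (R : realType) (n : nat) (A : 'M[R]_n) : 'M[R]_n :=
  limn (series (fun k : nat => (k`!%:R)^-1 *: A ^+ k)).

Definition wnorm (R : realType) (n : nat) (G : 'M[R]_n) (v : 'cV[R]_n) : R :=
  Num.sqrt ((v^T *m G *m v) ord0 ord0).

Definition enorm (R : realType) (n : nat) (v : 'cV[R]_n) : R :=
  wnorm 1%:M v.

Definition controllable (R : realType) (n m : nat)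
    (A : 'M[R]_n) (B : 'M[R]_(n, m)) : Prop :=
  forall x0 x1 : 'cV[R]_n,
  exists (T : R) (u : R -> 'cV[R]_m) (x : R -> 'cV[R]_n),
    [/\ 0 < T,
        {within `[0, T], continuous u},
        {within `[0, T], continuous x},
        forall t : R, 0 < t < T -> is_derive t 1 x (A *m x t + B *m u t)
      & x 0 = x0 /\ x T = x1].

(* The integral is entrywise; invmx is the inverse only when the integral is
   invertible, which holds when (A, B) is controllable and 0 < Th. *)
Definition invgram (R : realType) (n m : nat) (Th : R)
    (A : 'M[R]_n) (B : 'M[R]_(n, m)) : 'M[R]_n :=
  invmx (\matrix_(k < n, l < n)
    \int[@lebesgue_measure R]_(t in `[0, Th])
      (expmx (- t *: A) *m B *m B^T *m expmx (- t *: A^T)) k l).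

Section EntropicOT.
Variables (R : realType) (N : nat).

Definition couplings : set 'M[R]_N :=
  [set P : 'M[R]_N | [/\ forall i j, 0 <= P i j,
               P *m (const_mx 1 : 'cV[R]_N) = const_mx (N%:R^-1)
             & P^T *m (const_mx 1 : 'cV[R]_N) = const_mx (N%:R^-1)]].

(* The convention 0 log 0 = 0 holds because 0 * _ = 0. *)
Definition entropy (P : 'M[R]_N) : R :=
  - \sum_(i < N) \sum_(j < N) P i j * (ln (P i j) - 1).

Definition eot_cost (eps : R) (C P : 'M[R]_N) : R :=
  \sum_(i < N) \sum_(j < N) C i j * P i j - eps * entropy P.

Definition eot_minimizer (eps : R) (C P : 'M[R]_N) : Prop :=
  couplings P /\ forall Q, couplings Q -> eot_cost eps C P <= eot_cost eps C Q.

(* The minimizer exists and is unique when 0 < N and 0 < eps; the default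
   value 0 of xget is then never used. *)
Definition eot_plan (eps : R) (C : 'M[R]_N) : 'M[R]_N :=
  xget 0 [set P | eot_minimizer eps C P].

End EntropicOT.

(* R^(nN), whose elements are the stacked vectors \mxcol_(i < N) x_i. *)
Notation stacked R N n := 'cV[R]_(\sum_(i < N) n).

Section System.
Variables (R : realType) (N n m : nat) (Th eps : R).
Variables (A : 'I_N -> 'M[R]_n) (B : 'I_N -> 'M[R]_(n, m)).
Variable xd : 'I_N -> 'cV[R]_n.

Definition block (x : stacked R N n) (i : 'I_N) : 'cV[R]_n :=
  @submxcol R N (fun=> n) 1%N x i.

Definition gram (i : 'I_N) : 'M[R]_n := invgram Th (A i) (B i).

Definition ot_cost (x : stacked R N n) : 'M[R]_N :=
  \matrix_(i < N, j < N) wnorm (gram i) (block x i - xd j) ^+ 2.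

Definition Pstar (x : stacked R N n) : 'M[R]_N := eot_plan eps (ot_cost x).

Definition deviation (x : stacked R N n) (i : 'I_N) : 'cV[R]_n :=
  block x i - N%:R *: \sum_(j < N) Pstar x i j *: xd j.

Definition closed_loop (x : stacked R N n) : stacked R N n :=
  \mxcol_(i < N) ((A i - B i *m (B i)^T *m gram i) *m deviation x i).

Definition drift (x : stacked R N n) : stacked R N n :=
  \mxcol_(i < N) (A i *m deviation x i).

Definition Mset : set (stacked R N n) :=
  [set x | forall i,
     (B i)^T *m gram i *m deviation x i = 0 /\
     (B i)^T *m expmx (- Th *: (A i)^T) *m gram i *m deviation x i = 0].

End System.

Section Dynamics.
Variables (R : realType) (k : nat).
Implicit Types (f : 'cV[R]_k -> 'cV[R]_k) (x : R -> 'cV[R]_k).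
Implicit Types M K : set 'cV[R]_k.

(* Values of x at negative times are irrelevant. *)
Definition forward_solution f x : Prop :=
  x t @[t --> 0^'+] --> x 0 /\ forall t : R, 0 < t -> is_derive t 1 x (f (x t)).

Definition trajectory f x : Prop := forall t : R, is_derive t 1 x (f (x t)).

Definition invariant_set f M : Prop :=
  forall x, trajectory f x -> M (x 0) -> forall t, M (x t).

Definition largest_invariant f K : set 'cV[R]_k :=
  \bigcup_(M in [set M | invariant_set f M /\ M `<=` K]) M.

Lemma largest_invariantP f K :
  [/\ invariant_set f (largest_invariant f K),
      largest_invariant f K `<=` K
    & forall M, invariant_set f M -> M `<=` K -> M `<=` largest_invariant f K].
Proof.
split.
- move=> x xf [M [Minv MK] Mx0] t.
  by exists M => //; exact: Minv.
- by move=> y [M [_ MK] /MK].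
- by move=> M Minv MK y My; exists M.
Qed.

(* The infimum is taken in the extended reals, so that no trajectory converges
   to the empty set. *)
Definition converges_to_set x M : Prop :=
  ereal_inf [set (enorm (x t - y))%:E | y in M] @[t --> +oo] --> 0%E.

End Dynamics.

(* Main.v *)
Require Import Defs.
From HB Require Import structures.
From mathcomp Require Import all_boot all_order all_algebra.
From mathcomp Require Import all_classical all_reals all_analysis.
From mathcomp Require Import ring lra.

Import Order.TTheory GRing.Theory Num.Theory.
Import numFieldNormedType.Exports.

Local Open Scope classical_set_scope.
Local Open Scope ring_scope.

Set Implicit Arguments.
Unset Strict Implicit.
Unset Printing Implicit Defensive.

(** The optimal value V(x) of the entropic transport problem is a Lyapunov
    function, and the conclusion is an instance of LaSalle's principle.

    Expanding the squared norms, the term of C_ij that is quadratic in x_i depends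
    on i only, so it is irrelevant to the optimal plan, whose row sums are fixed:
    P*(x) is determined by a cost that is affine in x. Strong convexity of the
    negative entropy on the couplings makes the optimal plan a Lipschitz function
    of this cost ([eot_plan_lipschitz]). Hence P*, the deviations and both vector
    fields are globally Lipschitz in x ([lipfun_Pstar], [lipfun_drift]).

    By the envelope theorem ([is_derive_envelope]) the derivative of V along a
    solution is (2 / N) sum_i d_i^T G_i (A_i - B_i B_i^T G_i) d_i, where d_i is the
    deviation. The Lyapunov equation of the Gramian, which is the fundamental
    theorem of calculus applied to e^(-At) B B^T e^(-A^T t), turns it into
    - (1 / N) sum_i (|B_i^T G_i d_i|^2 + |B_i^T e^(-A_i^T Th) G_i d_i|^2)
    ([invgram_lyapunov], [quad_closed_loop], [is_derive_lyapunov]). This uses that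
    the Gramian is invertible, a consequence of controllability
    ([gramian_unit]). Since V is nonincreasing and the quadratic forms G_i are
    coercive, the solution is bounded ([bounded_trajectory]), and Barbalat's lemma
    makes both residuals tend to zero ([residual_vanishes]). Therefore every limit
    point of the solution lies in M', and the closed loop differs from the drift
    by a vanishing term along the solution ([closed_loop_drift]).

    A Groenwall comparison of translates of the solution with a trajectory of the
    drift issued from a limit point shows that this trajectory consists of limit
    points ([limit_set_invariant]). The limit set is thus an invariant set
    contained in M', and a bounded curve converges to its limit set
    ([limit_set_attracts]). *)

(** * Calculus of scalar and matrix valued functions *)

Lemma is_derive_cont (R : realType) (V : normedModType R) (f : R -> V) (t : R) (d : V) :
  is_derive t 1 f d -> {for t, continuous f}.
Proof.
by move=> df; apply/differentiable_continuous/derivable1_diffP; exact: ex_derive.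
Qed.

Lemma is_derive_add (R : realType) (f g : R -> R) (t df dg : R) :
  is_derive t 1 f df -> is_derive t 1 g dg ->
  is_derive t 1 (fun s => f s + g s) (df + dg).
Proof. by move=> hf hg; exact: is_deriveD. Qed.

Lemma is_derive_mul (R : realType) (f g : R -> R) (t df dg : R) :
  is_derive t 1 f df -> is_derive t 1 g dg ->
  is_derive t 1 (fun s => f s * g s) (df * g t + f t * dg).
Proof.
move=> hf hg; apply: (is_derive_eq (is_deriveM hf hg)).
by rewrite addrC mulrC.
Qed.

Lemma is_derive_bigsum (R : realType) (n : nat) (f : 'I_n -> R -> R) (t : R)
    (df : 'I_n -> R) :
  (forall i, is_derive t 1 (f i) (df i)) ->
  is_derive t 1 (fun s => \sum_(i < n) f i s) (\sum_(i < n) df i).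
Proof.
move=> hf; have := is_derive_sum hf.
by rewrite (_ : \sum_(i < n) f i = fun s => \sum_(i < n) f i s)//;
   apply/funext => s; rewrite fct_sumE.
Qed.

(** The chain rule for an affine change of time. *)
Lemma is_derive_affine (R : realType) (f : R -> R) (a b t df : R) :
  is_derive (a + b * t) 1 f df ->
  is_derive t 1 (fun s => f (a + b * s)) (b * df).
Proof.
move=> hf.
have hg : is_derive t 1 (fun s => a + b * s) b.
  rewrite -[b in X in is_derive _ _ _ X]mulr1 -[X in is_derive _ _ _ X]add0r.
  exact: is_derive_add.
by have := @is_derive1_comp R f (fun s => a + b * s) t df b hf hg; rewrite mulrC.
Qed.

Lemma is_derive_mxP (R : realType) (m n : nat) (M : R -> 'M[R]_(m, n)) (t : R)
    (D : 'M[R]_(m, n)) :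
  is_derive t 1 M D <-> forall i j, is_derive t 1 (fun s => M s i j) (D i j).
Proof.
split=> [hM i j|hM].
  have dM : derivable M t 1 by exact: ex_derive.
  split; first by move/derivable_mxP : dM; exact.
  by have := derive_mx dM; rewrite (@derive_val _ _ _ _ _ _ _ hM) => ->; rewrite mxE.
have dM : derivable M t 1.
  by apply/derivable_mxP => i j; exact: ex_derive.
split=> //; rewrite derive_mx//; apply/matrixP => i j; rewrite mxE.
exact: derive_val.
Qed.

Lemma is_derive_mulmx (R : realType) (m n p : nat) (M : R -> 'M[R]_(m, n))
    (P : R -> 'M[R]_(n, p)) (t : R) (dM : 'M[R]_(m, n)) (dP : 'M[R]_(n, p)) :
  is_derive t 1 M dM -> is_derive t 1 P dP ->
  is_derive t 1 (fun s => M s *m P s) (dM *m P t + M t *m dP).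
Proof.
move=> /is_derive_mxP hM /is_derive_mxP hP; apply/is_derive_mxP => i j.
rewrite (_ : (fun s => _) = fun s => \sum_k M s i k * P s k j); last first.
  by apply/funext => s; rewrite mxE.
rewrite !mxE -big_split; apply: is_derive_bigsum => k.
exact: is_derive_mul.
Qed.

Lemma is_derive_trmx (R : realType) (m n : nat) (M : R -> 'M[R]_(m, n)) (t : R)
    (dM : 'M[R]_(m, n)) :
  is_derive t 1 M dM -> is_derive t 1 (fun s => (M s)^T) dM^T.
Proof.
move=> /is_derive_mxP hM; apply/is_derive_mxP => i j.
by rewrite (_ : (fun s => _) = fun s => M s j i) ?mxE//;
   apply/funext => s; rewrite mxE.
Qed.

Lemma cvg_sumr (R : realType) (T I : Type) (F : set_system T) (r : seq I)
    (f : I -> T -> R) (l : I -> R) : Filter F ->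
  (forall i, f i x @[x --> F] --> l i) ->
  \sum_(i <- r) f i x @[x --> F] --> \sum_(i <- r) l i.
Proof.
move=> FF fl; elim: r => [|i r IHr].
  rewrite big_nil; under eq_fun do rewrite big_nil; exact: cvg_cst.
rewrite big_cons; under eq_fun do rewrite big_cons.
by apply: cvgD.
Qed.

Lemma cvg_mx (R : realType) (m n : nat) (T : Type) (F : set_system T)
    (M : T -> 'M[R]_(m, n)) (L : 'M[R]_(m, n)) : Filter F ->
  (forall i j, M x i j @[x --> F] --> L i j) -> M x @[x --> F] --> L.
Proof.
move=> FF hM; apply/cvgrPdist_le => e e0; near=> s.
rewrite [leLHS]/Num.Def.normr/= mx_normrE; apply: bigmax_le; first exact: ltW.
move=> ij _; rewrite !mxE; move: ij.
near: s; apply: filter_forall => -[i j] /=.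
by have /cvgrPdist_le := hM i j; exact.
Unshelve. all: by end_near. Qed.

Lemma cvg_coord (R : realType) (m n : nat) (T : Type) (F : set_system T)
    (M : T -> 'M[R]_(m, n)) (L : 'M[R]_(m, n)) i j : Filter F ->
  M x @[x --> F] --> L -> M x i j @[x --> F] --> L i j.
Proof.
move=> FF hM; apply: (@cvg_comp _ _ _ M (fun A : 'M[R]_(m, n) => A i j) _ _ _ hM).
exact: coord_continuous.
Qed.

(** The mean value theorem, for functions differentiable on a closed interval. *)
Lemma mean_value (R : realType) (f df : R -> R) (a b : R) : a < b ->
  (forall t, a <= t <= b -> is_derive t 1 f (df t)) ->
  exists c, a < c < b /\ f b - f a = df c * (b - a).
Proof.
move=> ab hf.
have [||c] := @MVT R f df a b ab.
- move=> t; rewrite in_itv/= => /andP[at_ tb]; apply: hf.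
  by rewrite !ltW.
- apply: continuous_in_subspaceT => t; rewrite inE/= in_itv/= => tab.
  by have := is_derive_cont (hf t tab).
by rewrite in_itv/= => cab ->; exists c.
Qed.

(** Barbalat's lemma, in the form used with a Lyapunov function V: a nonnegative
    Lipschitz dissipation rate w = - V' vanishes at infinity when V is bounded
    below. *)
Lemma barbalat (R : realType) (V w : R -> R) (a c K : R) :
  (forall t, a <= t -> is_derive t 1 V (- w t)) ->
  (forall t, a <= t -> 0 <= w t) ->
  (forall t, a <= t -> c <= V t) ->
  (forall s t, a <= s -> s <= t -> `|w t - w s| <= K * (t - s)) ->
  forall e, 0 < e -> exists T, a <= T /\ forall t, T <= t -> w t < e.
Proof.
move=> dV w0 Vc wK e e0.
have Vle s t : a <= s -> s <= t -> V t <= V s.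
  move=> as_; rewrite le_eqVlt => /predU1P[->//|st].
  have [u|u [/andP[su ut] E]] := mean_value (f := V) (df := fun t => - w t) st.
    by move=> /andP[su ut]; apply: dV; exact: le_trans su.
  have := w0 u (le_trans as_ (ltW su)); nra.
(* On a time interval of length h the rate stays above e / 2. *)
pose h := e / (2 * (`|K| + 1)).
have K1 : 0 < `|K| + 1 by rewrite ltr_wpDl.
have h0 : 0 < h by rewrite divr_gt0// mulr_gt0.
pose S : set R := [set V t | t in [set t | a <= t]].
have iS : has_inf S.
  split; first by exists (V a), a => //=.
  by exists c => _ [t at_ <-]; exact: Vc.
have z0 : 0 < h * (e / 2) by rewrite mulr_gt0 // divr_gt0.
have [_ [T aT <-] VT] := inf_adherent z0 iS.
exists T; split=> // t Tt; rewrite ltNge; apply/negP => ew.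
have at_ : a <= t by exact: le_trans Tt.
have th : t < t + h by rewrite ltrDl.
have [u|u [/andP[tu uth] E]] := mean_value (f := V) (df := fun t => - w t) th.
  by move=> /andP[tu _]; apply: dV; exact: le_trans tu.
have wu : e / 2 <= w u.
  have hK : `|K| * h <= e / 2.
    rewrite /h mulrCA ler_pM2l// invfM mulrCA ler_piMr ?invr_ge0//.
    by rewrite ler_pdivrMr// mul1r lerDl.
  have : `|w u - w t| <= `|K| * h.
    apply: (le_trans (wK t u at_ (ltW tu))).
    have := ler_norm K; have := normr_ge0 K; nra.
  rewrite ler_norml => /andP[+ _]; lra.
have : inf S <= V (t + h).
  apply: ge_inf; first by case: iS.
  by exists (t + h) => //=; apply: le_trans at_ (ltW th).
have := Vle T t aT Tt.
have : - w u * (t + h - t) <= - (h * (e / 2)) by nra.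
rewrite /h in E VT *; lra.
Qed.

(** Groenwall's inequality for a differential inequality with constant
    coefficients, the coefficient of the unknown being at least 1. *)
Lemma gronwall (R : realType) (f df : R -> R) (T c b : R) :
  1 <= c -> 0 <= b -> 0 <= T ->
  (forall t, 0 <= t <= T -> is_derive t 1 f (df t)) ->
  (forall t, 0 <= t <= T -> df t <= c * f t + b) ->
  f T <= (f 0 + b) * expR (c * T).
Proof.
move=> c1 b0; rewrite le_eqVlt => /predU1P[<- _ _|T0 hf hdf].
  by rewrite mulr0 expR0 mulr1 lerDl.
pose g t := (f t + b) * expR (- c * t).
pose dg t := df t * expR (- c * t) + (f t + b) * (- c * expR (- c * t)).
have [t tT|u [/andP[u0 uT]]] := mean_value (f := g) (df := dg) T0.
  apply: is_derive_mul.
    rewrite -[df t]addr0; have ft := hf t tT; exact: is_derive_add.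
  have := @is_derive_affine R expR 0 (- c) t (expR (- c * t)).
  by under eq_fun do rewrite add0r; rewrite add0r; apply.
rewrite subr0 => E.
have gT : g T <= g 0.
  rewrite -subr_le0 E /dg mulrCA mulrA -mulrDl.
  have du : df u <= c * f u + b by apply: hdf; rewrite (ltW u0) ltW.
  have e0 := expR_gt0 (- c * u).
  have h : df u + - c * (f u + b) <= 0 by nra.
  by rewrite -mulrA mulr_le0_ge0// mulr_ge0// ltW.
move: gT; rewrite /g mulr0 expR0 mulr1 mulNr expRN ler_pdivrMr ?expR_gt0//.
by move=> h; apply: le_trans h; rewrite lerDl.
Qed.

(** A two-sided version of Groenwall's inequality. *)
Lemma gronwall2 (R : realType) (f df : R -> R) (T c b : R) :
  1 <= c -> 0 <= b ->
  (forall t : R, `|t| <= `|T| -> is_derive t 1 f (df t)) ->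
  (forall t : R, `|t| <= `|T| -> `|df t| <= c * f t + b) ->
  f T <= (f 0 + b) * expR (c * `|T|).
Proof.
move=> c1 b0 hf hdf; have [T0|T0] := leP 0 T.
  have nT t : 0 <= t <= T -> `|t| <= `|T|.
    by move=> /andP[t0 tT]; rewrite !ger0_norm.
  rewrite ger0_norm//; apply: (gronwall (f := f) (df := df)) => // t /nT tT; first exact: hf.
  exact: le_trans (ler_norm _) (hdf _ tT).
have nT t : 0 <= t <= - T -> `|0 + -1 * t| <= `|T|.
  by rewrite add0r mulN1r normrN => /andP[t0 tT]; rewrite (ger0_norm t0) (ltr0_norm T0).
have /= := gronwall (f := fun t => f (0 + -1 * t)) (df := fun t => -1 * df (0 + -1 * t))
  (T := - T) c1 b0.
rewrite mulr0 addr0 add0r mulN1r opprK ltr0_norm//; apply.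
- by rewrite oppr_ge0 ltW.
- by move=> t /nT tT; apply: is_derive_affine; exact: hf.
- move=> t /nT tT; rewrite mulN1r; apply: le_trans (hdf _ tT).
  by rewrite -normrN ler_norm.
Qed.

(** The envelope theorem along a curve: if the increments of V are sandwiched
    between those of the costs C i weighted by the plans at both ends, then V is
    differentiable and only the costs contribute to its derivative. *)
Lemma is_derive_envelope (R : realType) (I : finType) (V : R -> R)
    (C P : I -> R -> R) (dC : I -> R) (t : R) :
  (forall i, is_derive t 1 (C i) (dC i)) ->
  (forall i, {for t, continuous (P i)}) ->
  (forall s, \sum_i (C i s - C i t) * P i s <= V s - V t) ->
  (forall s, V s - V t <= \sum_i (C i s - C i t) * P i t) ->
  is_derive t 1 V (\sum_i dC i * P i t).
Proof.
move=> hC hP Vl Vu.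
have /choice[h hh] : forall i, exists g : R -> R,
    [/\ forall z, C i z - C i t = g z * (z - t), {for t, continuous g} & g t = dC i].
  by move=> i; apply/is_derive1_caratheodory; exact: hC.
pose a := \sum_i dC i * P i t.
pose u s := \sum_i h i s * P i t.
pose r s := \sum_i `|h i s| * `|P i s - P i t|.
apply/is_derive1_caratheodory.
exists (fun s => if s == t then a else (V s - V t) / (s - t)); split.
- move=> s; case: eqP => [->|/eqP]; first by rewrite !subrr mulr0.
  by rewrite -subr_eq0 => /divfK ->.
- have ut : u s @[s --> t] --> a.
    apply: cvg_sumr => i; apply: cvgMl.
    by case: (hh i) => _ ch <-; exact: ch.
  have rt : r s @[s --> t] --> 0.
    rewrite (_ : 0 = \sum_(i : I) `|h i t| * `|P i t - P i t|); last first.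
      by rewrite big1// => i _; rewrite subrr normr0 mulr0.
    apply: cvg_sumr => i; apply: cvgM.
      by apply: cvg_norm; case: (hh i) => _ ch _; exact: ch.
    by apply: cvg_norm; apply: cvgB; [exact: hP|exact: cvg_cst].
  rewrite /prop_for /continuous_at /= eqxx.
  have H s : `|u s - (if s == t then a else (V s - V t) / (s - t))| <= r s.
    have r0 : 0 <= r s by apply: sumr_ge0 => i _; rewrite mulr_ge0.
    case: eqP => [->|/eqP st].
      rewrite (_ : u t = a) ?subrr ?normr0//; last first.
        by apply: eq_bigr => i _; case: (hh i) => _ _ ->.
      by apply: sumr_ge0 => i _; rewrite mulr_ge0.
    have st0 : s - t != 0 by rewrite subr_eq0.
    rewrite -(@ler_pM2r _ `|s - t|) ?normr_gt0//.
    rewrite -normrM mulrBl divfK//.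
    have E1 : u s * (s - t) = \sum_i (C i s - C i t) * P i t.
      rewrite mulr_suml; apply: eq_bigr => i _.
      by case: (hh i) => -> _ _; rewrite mulrAC.
    rewrite E1 ger0_norm ?subr_ge0//.
    apply: (@le_trans _ _ (\sum_i (C i s - C i t) * (P i t - P i s))).
      rewrite lerBlDr -lerBlDl; apply: le_trans (Vl s).
      rewrite -sumrB le_eqVlt; apply/orP; left; apply/eqP.
      by apply: eq_bigr => i _; rewrite -mulrBr; congr (_ * _); ring.
    rewrite /r mulr_suml; apply: ler_sum => i _; case: (hh i) => -> _ _.
    apply: le_trans (ler_norm _) _.
    by rewrite !normrM (distrC (P i t)) mulrAC.
  have ut' : u s - (u s - (if s == t then a else (V s - V t) / (s - t)))
      @[s --> t] --> a - 0.
    apply: cvgB => //; apply/cvgrPdist_le => e e0.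
    have /cvgrPdist_le /(_ e e0) := rt; apply: filterS => s /=.
    rewrite !sub0r !normrN => re; apply: le_trans (H s) _.
    by apply: le_trans re; exact: ler_norm.
  move: ut'; rewrite subr0; apply: cvg_trans; apply: near_eq_cvg.
  by apply: nearW => s; rewrite opprB addrC subrK.
- by rewrite eqxx.
Qed.

(** * The matrix exponential *)

(** The coefficients b k / k! of the exponential generating series of b. *)
Definition expcoef (R : realType) (b : nat -> R) : R^nat :=
  fun k => (k`!%:R)^-1 * b k.

(** At most geometric growth, which makes the exponential generating series
    converge everywhere. *)
Definition geom_bounded (R : realType) (b : nat -> R) : Prop :=
  exists C a : R, [/\ 0 <= C, 0 <= a & forall k, `|b k| <= C * a ^+ k].

Lemma geom_boundedS (R : realType) (b : nat -> R) :
  geom_bounded b -> geom_bounded (fun k => b k.+1).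
Proof.
move=> [C [a [C0 a0 hb]]]; exists (C * a), a; split=> //; first exact: mulr_ge0.
by move=> k; rewrite -mulrA -exprS.
Qed.

Lemma cvg_expcoef (R : realType) (b : nat -> R) (x : R) :
  geom_bounded b -> cvgn (pseries (expcoef b) x).
Proof.
move=> [C [a [C0 a0 hb]]].
apply: normed_cvg; rewrite /normed_series_of /=.
apply: (@series_le_cvg _ _ (C *: exp_coeff (a * `|x|))).
- by move=> k; exact: normr_ge0.
- move=> k; rewrite /= /exp_coeff /= mulr_ge0// divr_ge0// exprn_ge0//.
  by rewrite mulr_ge0.
- move=> k; rewrite /expcoef /GRing.scale /= /exp_coeff /= !normrM normfV normr_nat normrX.
  rewrite exprMn.
  have := hb k => hk.
  have f0 : 0 <= (k`!%:R : R)^-1 by rewrite invr_ge0.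
  have x0 : 0 <= `|x| ^+ k by rewrite exprn_ge0.
  have : (`|b k| * `|x| ^+ k) * (k`!%:R)^-1 <= (C * a ^+ k * `|x| ^+ k) * (k`!%:R)^-1.
    by rewrite ler_wpM2r// ler_wpM2r.
  move=> h; apply: le_trans (le_trans h _); rewrite le_eqVlt; apply/orP; left; apply/eqP.
    by ring.
  by rewrite /GRing.scale /=; ring.
- rewrite (_ : series _ = fun k => C * series (exp_coeff (a * `|x|)) k).
    by apply: is_cvgMr; exact: is_cvg_series_exp_coeff.
  by apply/funext => k; rewrite /series /= mulr_sumr.
Qed.

Lemma pseries_diffs_expcoef (R : realType) (b : nat -> R) :
  pseries_diffs (expcoef b) = expcoef (fun k => b k.+1).
Proof.
apply/funext => k; rewrite /pseries_diffs /expcoef factS natrM invfM mulrA mulrA.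
by rewrite mulfV ?mul1r// pnatr_eq0.
Qed.

Lemma is_derive_expcoef (R : realType) (b : nat -> R) (x : R) :
  geom_bounded b ->
  is_derive x 1 (fun x => limn (pseries (expcoef b) x))
    (limn (pseries (expcoef (fun k => b k.+1)) x)).
Proof.
move=> hb; rewrite -pseries_diffs_expcoef.
have hb' := geom_boundedS hb; have hb'' := geom_boundedS hb'.
apply: (@pseries_snd_diffs _ _ (`|x| + 1)).
- exact: cvg_expcoef.
- by rewrite pseries_diffs_expcoef; exact: cvg_expcoef.
- by rewrite 2!pseries_diffs_expcoef; exact: cvg_expcoef.
- by rewrite [ltRHS]ger0_norm ?ltrDl// addr_ge0.
Qed.

Lemma geom_bounded_mx (R : realType) (n : nat) (A : 'M[R]_n) i j :
  geom_bounded (fun k => (A ^+ k) i j).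
Proof.
pose a := \sum_i \sum_j `|A i j|.
have a0 : 0 <= a by apply: sumr_ge0 => *; apply: sumr_ge0.
exists 1, a; split=> // k; rewrite mul1r; elim: k i j => [|k IHk] i j.
  rewrite !expr0 -idmxE mxE; case: (i == j) => /=; first by rewrite normr1.
  by rewrite normr0.
rewrite exprS -mulmxE mxE; apply: (le_trans (ler_norm_sum _ _ _)).
apply: (@le_trans _ _ ((\sum_l `|A i l|) * a ^+ k)).
  rewrite mulr_suml; apply: ler_sum => l _.
  by rewrite normrM ler_wpM2l.
rewrite exprS ler_wpM2r ?exprn_ge0// /a [leRHS](bigD1 i)//= lerDl.
by apply: sumr_ge0 => *; apply: sumr_ge0.
Qed.

Lemma exprZ_mx (R : realType) (n : nat) (t : R) (A : 'M[R]_n) k :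
  (t *: A) ^+ k = t ^+ k *: A ^+ k.
Proof.
elim: k => [|k IHk]; first by rewrite !expr0 scale1r.
by rewrite !exprS -!mulmxE IHk -scalemxAl -scalemxAr scalerA.
Qed.

(** The entries of the exponential are scalar power series in time. *)
Lemma expmx_cvg (R : realType) (n : nat) (A : 'M[R]_n) (t : R) i j :
  pseries (expcoef (fun k => (A ^+ k) i j)) t @ \oo --> expmx (t *: A) i j.
Proof.
pose L := \matrix_(i, j) limn (pseries (expcoef (fun k => (A ^+ k) i j)) t).
suff -> : expmx (t *: A) = L.
  by rewrite mxE; apply: cvg_expcoef; exact: geom_bounded_mx.
apply: cvg_lim => //; apply: cvg_mx => i' j'; rewrite mxE.
rewrite (_ : (fun m => _) = pseries (expcoef (fun k => (A ^+ k) i' j')) t).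
  by apply: cvg_expcoef; exact: geom_bounded_mx.
apply/funext => m; rewrite /series /= summxE; apply: eq_bigr => k _.
by rewrite mxE exprZ_mx mxE /expcoef /=; ring.
Qed.

Lemma expmx_tr (R : realType) (n : nat) (A : 'M[R]_n) (t : R) :
  expmx (t *: A^T) = (expmx (t *: A))^T.
Proof.
have trX k : (A^T) ^+ k = (A ^+ k)^T.
  elim: k => [|k IHk]; first by rewrite !expr0 -idmxE trmx1.
  by rewrite exprS exprSr -!mulmxE IHk trmx_mul.
apply/matrixP => i j; rewrite [RHS]mxE.
have h1 := @expmx_cvg R n A^T t i j; have h2 := @expmx_cvg R n A t j i.
apply: (cvg_unique _ h1) => //.
rewrite (_ : (fun k => _) = fun k => (A ^+ k) j i)//.
by apply/funext => k; rewrite trX mxE.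
Qed.

Lemma expmx0 (R : realType) (n : nat) (A : 'M[R]_n) : expmx (0 *: A) = 1%:M.
Proof.
apply/matrixP => i j.
suff h : pseries (expcoef (fun k => (A ^+ k) i j)) 0 @ \oo --> (1%:M : 'M[R]_n) i j.
  by apply: (cvg_unique _ (@expmx_cvg R n A 0 i j)) => //; exact: h.
rewrite -cvg_shiftS /= (_ : (fun k => _) = cst ((1%:M : 'M[R]_n) i j)).
  exact: cvg_cst.
apply/funext => k; rewrite /pseries /series /= big_nat_recl//= big1 ?addr0.
  by rewrite /expcoef !expr0 fact0 invr1 mul1r mulr1 idmxE.
by move=> l _; rewrite expr0n mulr0.
Qed.

Lemma is_derive_expmx (R : realType) (n : nat) (A : 'M[R]_n) (t : R) :
  is_derive t 1 (fun s => expmx (- s *: A)) (- (A *m expmx (- t *: A))).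
Proof.
apply/is_derive_mxP => i j; rewrite mxE.
pose g (s : R) := limn (pseries (expcoef (fun k => (A ^+ k) i j)) s).
rewrite (_ : (fun s => _) = fun s => g (0 + -1 * s)); last first.
  apply/funext => s; rewrite add0r mulN1r /g; apply/esym.
  by apply: cvg_lim => //; exact: expmx_cvg.
rewrite -[X in is_derive _ _ _ X]mulN1r; apply: is_derive_affine.
rewrite add0r mulN1r.
have := is_derive_expcoef (- t) (geom_bounded_mx A i j).
congr is_derive; apply: cvg_lim => //; rewrite mxE.
rewrite (_ : pseries _ _ = fun m => \sum_l A i l *
   pseries (expcoef (fun k => (A ^+ k) l j)) (- t) m).
  apply: cvg_sumr => l; apply: cvgMr; exact: expmx_cvg.
apply/funext => m; rewrite /pseries /series /=.
under [RHS]eq_bigr do rewrite mulr_sumr.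
rewrite exchange_big; apply: eq_bigr => k _; rewrite /expcoef exprS -mulmxE mxE.
rewrite mulr_sumr mulr_suml; apply: eq_bigr => l _; ring.
Qed.

(** A matrix commutes with its exponential. *)
Lemma expmx_comm (R : realType) (n : nat) (A : 'M[R]_n) (t : R) :
  A *m expmx (t *: A) = expmx (t *: A) *m A.
Proof.
apply/matrixP => i j; rewrite !mxE.
have h1 : (fun m => \sum_l A i l *
   pseries (expcoef (fun k => (A ^+ k) l j)) t m) @ \oo -->
   \sum_l A i l * expmx (t *: A) l j.
  by apply: cvg_sumr => l; apply: cvgMr; exact: expmx_cvg.
apply: (cvg_unique _ h1) => //.
rewrite (_ : (fun m => _) = fun m => \sum_l 
   pseries (expcoef (fun k => (A ^+ k) i l)) t m * A l j).
  by apply: cvg_sumr => l; apply: cvgMl; exact: expmx_cvg.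
apply/funext => m; rewrite /pseries /series /=.
under eq_bigr do rewrite mulr_sumr.
under [RHS]eq_bigr do rewrite mulr_suml.
rewrite exchange_big [RHS]exchange_big; apply: eq_bigr => k _.
transitivity ((k`!%:R)^-1 * (A ^+ k.+1) i j * t ^+ k); rewrite /expcoef.
  rewrite exprS -mulmxE mxE mulr_sumr mulr_suml; apply: eq_bigr => l _; ring.
rewrite exprSr -mulmxE mxE mulr_sumr mulr_suml; apply: eq_bigr => l _; ring.
Qed.

(** * Integrals of matrix valued functions and the Gramian *)

(** Entrywise continuity of a matrix valued function of time. *)
Definition contmx (R : realType) (m n : nat) (M : R -> 'M[R]_(m, n)) : Prop :=
  forall i j, continuous (fun t => M t i j).

(** The entrywise integral of M over [0, T]. *)
Definition intmx (R : realType) (m n : nat) (T : R) (M : R -> 'M[R]_(m, n)) :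
    'M[R]_(m, n) :=
  \matrix_(i < m, j < n) \int[@lebesgue_measure R]_(t in `[0, T]) M t i j.

Lemma is_derive_contmx (R : realType) (m n : nat) (M dM : R -> 'M[R]_(m, n)) :
  (forall t : R, is_derive t 1 M (dM t)) -> contmx M.
Proof.
move=> hM i j t; have /is_derive_mxP h := hM t.
exact: (is_derive_cont (h i j)).
Qed.

Lemma contmx_mull (R : realType) (m n p : nat) (P : 'M[R]_(m, n))
    (M : R -> 'M[R]_(n, p)) : contmx M -> contmx (fun t => P *m M t).
Proof.
move=> hM i j t; rewrite /continuous_at mxE; under eq_fun do rewrite mxE.
by apply: cvg_sumr => k; apply: cvgMr; exact: hM.
Qed.

Lemma contmx_mulr (R : realType) (m n p : nat) (M : R -> 'M[R]_(m, n))
    (P : 'M[R]_(n, p)) : contmx M -> contmx (fun t => M t *m P).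
Proof.
move=> hM i j t; rewrite /continuous_at mxE; under eq_fun do rewrite mxE.
by apply: cvg_sumr => k; apply: cvgMl; exact: hM.
Qed.

Lemma contmxD (R : realType) (m n : nat) (M P : R -> 'M[R]_(m, n)) :
  contmx M -> contmx P -> contmx (fun t => M t + P t).
Proof.
move=> hM hP i j t; rewrite /continuous_at mxE; under eq_fun do rewrite mxE.
by apply: cvgD; [exact: hM|exact: hP].
Qed.

Lemma continuous_integrable (R : realType) (f : R -> R) (a b : R) :
  continuous f -> (@lebesgue_measure R).-integrable `[a, b] (EFin \o f).
Proof.
move=> cf; apply: continuous_compact_integrable; first exact: segment_compact.
exact: continuous_subspaceT.
Qed.

Lemma Rintegral_sum_continuous (R : realType) (n : nat) (f : 'I_n -> R -> R) (a b : R) :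
  (forall i, continuous (f i)) ->
  \int[@lebesgue_measure R]_(t in `[a, b]) (\sum_(i < n) f i t) =
  \sum_(i < n) \int[@lebesgue_measure R]_(t in `[a, b]) f i t.
Proof.
move=> cf; elim: n f cf => [|n IHn] f cf.
  under eq_Rintegral do rewrite big_ord0.
  by rewrite big_ord0 Rintegral_cst//= ?mul0r//; exact: measurable_itv.
under eq_Rintegral do rewrite big_ord_recl.
rewrite big_ord_recl RintegralD//=.
- by rewrite IHn// => i; exact: cf.
- exact: continuous_integrable.
- apply: continuous_integrable => t.
  by apply: cvg_sumr => i; exact: cf.
Qed.

Lemma intmx_mull (R : realType) (m n p : nat) (T : R) (P : 'M[R]_(m, n))
    (M : R -> 'M[R]_(n, p)) : contmx M ->
  intmx T (fun t => P *m M t) = P *m intmx T M.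
Proof.
move=> hM; apply/matrixP => i j; rewrite !mxE.
under eq_Rintegral do rewrite mxE.
rewrite Rintegral_sum_continuous; last by move=> k t; apply: cvgMr; exact: hM.
apply: eq_bigr => k _; rewrite RintegralZl ?mxE//.
exact: continuous_integrable.
Qed.

Lemma intmx_mulr (R : realType) (m n p : nat) (T : R) (M : R -> 'M[R]_(m, n))
    (P : 'M[R]_(n, p)) : contmx M ->
  intmx T (fun t => M t *m P) = intmx T M *m P.
Proof.
move=> hM; apply/matrixP => i j; rewrite !mxE.
under eq_Rintegral do rewrite mxE.
rewrite Rintegral_sum_continuous; last by move=> k t; apply: cvgMl; exact: hM.
apply: eq_bigr => k _; rewrite RintegralZr ?mxE//.
exact: continuous_integrable.
Qed.

Lemma intmxD (R : realType) (m n : nat) (T : R) (M P : R -> 'M[R]_(m, n)) :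
  contmx M -> contmx P ->
  intmx T (fun t => M t + P t) = intmx T M + intmx T P.
Proof.
move=> hM hP; apply/matrixP => i j; rewrite !mxE.
under eq_Rintegral do rewrite mxE.
by rewrite RintegralD//; exact: continuous_integrable.
Qed.

(** The fundamental theorem of calculus for matrix valued functions. *)
Lemma intmx_derive (R : realType) (m n : nat) (T : R) (M dM : R -> 'M[R]_(m, n)) :
  0 < T -> (forall t : R, is_derive t 1 M (dM t)) -> contmx dM ->
  intmx T dM = M T - M 0.
Proof.
move=> T0 hM cdM; apply/matrixP => i j; rewrite !mxE.
have hij (t : R) : is_derive t 1 (fun s => M s i j) (dM t i j).
  by have /is_derive_mxP := hM t; exact.
have cM : continuous (fun s => M s i j) by move=> t; exact: (is_derive_cont (hij t)).
rewrite /Rintegral (@continuous_FTC2 _ (fun t => dM t i j) (fun t => M t i j))//.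
- exact: continuous_subspaceT.
- split=> [t _||].
  + by have := hij t => -[].
  + exact: cvg_at_right_filter (cM 0).
  + exact: cvg_at_left_filter (cM T).
- by move=> t _; rewrite derive1E; exact: derive_val.
Qed.

(** A continuous nonnegative function with zero integral vanishes. *)
Lemma Rintegral0_continuous (R : realType) (f : R -> R) (T : R) :
  continuous f -> (forall t, 0 <= f t) ->
  \int[@lebesgue_measure R]_(t in `[0, T]) f t = 0 ->
  forall t, 0 < t < T -> f t = 0.
Proof.
move=> cf f0 If t /andP[t0 tT].
pose F x := \int[@lebesgue_measure R]_(t in `[0, x]) f t.
have F0 x : 0 < x < T -> F x = 0.
  move=> /andP[x0 xT]; apply/eqP; rewrite eq_le Rintegral_ge0 ?andbT//.
  have := @Rintegral_itvB R f (BLeft 0) (BRight T) x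
    (continuous_integrable 0 T cf).
  rewrite !bnd_simp => /(_ (ltW x0) (ltW xT)); rewrite If sub0r -/(F x).
  move=> E; rewrite -oppr_ge0 E; exact: Rintegral_ge0.
have [dF] := @continuous_FTC1_closed R f 0 t T tT
   (continuous_integrable 0 T cf) t0 (cf t).
rewrite -/F derive1E => <-.
have : is_derive t 1 F 0.
  apply: (@near_eq_is_derive _ _ _ (fun=> 0)).
  near=> x; rewrite F0//; apply/andP; split; near: x.
  - exact: lt_nbhsr.
  - exact: lt_nbhsl.
by move=> hF; rewrite derive_val.
Unshelve. all: by end_near. Qed.

Lemma continuous_eq0_right (R : realType) (f : R -> R) (T : R) :
  0 < T -> continuous f -> (forall t, 0 < t < T -> f t = 0) -> f 0 = 0.
Proof.
move=> T0 cf f0.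
have h1 : f x @[x --> 0^'+] --> f 0 by apply: cvg_at_right_filter; exact: cf.
have h2 : f x @[x --> 0^'+] --> (0 : R).
  apply: cvg_near_cst; near=> x; apply: f0.
  by apply/andP; split; near: x; [exact: nbhs_right_gt|exact: nbhs_right_lt].
exact: (cvg_unique _ h1 h2).
Unshelve. all: by end_near. Qed.

Lemma mulmx_tr_eq0 (R : realType) (n : nat) (v : 'rV[R]_n) :
  (v *m v^T) 0 0 = 0 -> v = 0.
Proof.
rewrite mxE => h; apply/rowP => j; rewrite mxE.
have H i : true -> 0 <= v 0 i * v^T i 0 by rewrite mxE -expr2 sqr_ge0.
have : v 0 j * v^T j 0 = 0 by exact: (psumr_eq0P H h).
by rewrite mxE => /eqP; rewrite mulf_eq0 orbb => /eqP.
Qed.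

Lemma mulmx_tr_ge0 (R : realType) (n : nat) (v : 'rV[R]_n) :
  0 <= (v *m v^T) 0 0.
Proof. by rewrite mxE; apply: sumr_ge0 => i _; rewrite mxE -expr2 sqr_ge0. Qed.

Section Gramian.
Variables (R : realType) (n m : nat) (Th : R) (A : 'M[R]_n) (B : 'M[R]_(n, m)).
Hypothesis Th0 : 0 < Th.
Hypothesis AB : controllable A B.

Local Notation E := (fun t : R => expmx (- t *: A)).
Local Notation M := (fun t : R => expmx (- t *: A) *m B *m B^T *m (expmx (- t *: A))^T).

(** The finite horizon controllability Gramian. *)
Definition gramian : 'M[R]_n := intmx Th M.
Local Notation W := gramian.
Local Notation G := (invgram Th A B).

Lemma invgramE : G = invmx W.
Proof.
rewrite /invgram; congr invmx; apply/matrixP => i j; rewrite !mxE.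
by apply: eq_Rintegral => t _; rewrite expmx_tr.
Qed.

Lemma is_derive_gram_integrand (t : R) :
  is_derive t 1 M (- (A *m M t + M t *m A^T)).
Proof.
have hE := is_derive_expmx A t.
have hB := is_derive_mulmx hE (is_derive_cst B t 1).
have hBB := is_derive_mulmx hB (is_derive_cst B^T t 1).
have := is_derive_mulmx hBB (is_derive_trmx hE).
congr is_derive; rewrite /cst !mulmx0 !addr0 linearN /= trmx_mul.
by rewrite !mulNmx mulmxN !mulmxA opprD.
Qed.

Lemma contmx_gram : contmx M.
Proof. by apply: is_derive_contmx => t; exact: is_derive_gram_integrand. Qed.

(** The Lyapunov equation of the Gramian. *)
Lemma gramian_lyapunov :
  A *m W + W *m A^T =
  B *m B^T - expmx (- Th *: A) *m B *m B^T *m (expmx (- Th *: A))^T.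
Proof.
have cM := contmx_gram.
have cAM := contmx_mull (P := A) cM.
have cMA := contmx_mulr (P := A^T) cM.
rewrite -intmx_mull// -intmx_mulr// -intmxD//.
have cD : contmx (fun t => - (A *m M t + M t *m A^T)).
  have -> : (fun t => - (A *m M t + M t *m A^T)) =
            (fun t => (- 1%:M) *m (A *m M t + M t *m A^T)).
    by apply/funext => t; rewrite mulNmx mul1mx.
  by apply: contmx_mull; exact: contmxD.
have := intmx_derive Th0 is_derive_gram_integrand cD.
have -> : intmx Th (fun t => - (A *m M t + M t *m A^T)) =
    - intmx Th (fun t => A *m M t + M t *m A^T).
  rewrite -[in RHS](mul1mx (intmx _ _)) -mulNmx -intmx_mull; last exact: contmxD.
  by congr intmx; apply/funext => t; rewrite mulNmx mul1mx.
move=> h; apply: oppr_inj; rewrite h oppr0 expmx0 trmx1 mulmx1 mul1mx opprB.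
by [].
Qed.

Lemma gramian_sym : W^T = W.
Proof.
apply/matrixP => i j; rewrite !mxE; apply: eq_Rintegral => t _.
have : (M t)^T = M t by rewrite !trmx_mul !trmxK !mulmxA.
by move=> /matrixP /(_ i j); rewrite mxE.
Qed.

Lemma gramian_quadE (v : 'rV[R]_n) :
  (v *m W *m v^T) 0 0 = \int[@lebesgue_measure R]_(t in `[0, Th])
    ((v *m E t *m B) *m (v *m E t *m B)^T) 0 0.
Proof.
rewrite -intmx_mull; last exact: contmx_gram.
rewrite -intmx_mulr; last exact/contmx_mull/contmx_gram.
by rewrite mxE; apply: eq_Rintegral => t _; rewrite !trmx_mul !mulmxA.
Qed.

Lemma gramian_psd (v : 'rV[R]_n) : 0 <= (v *m W *m v^T) 0 0.
Proof.
by rewrite gramian_quadE; apply: Rintegral_ge0 => t _; exact: mulmx_tr_ge0.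
Qed.

(** A row vector annihilating the curve of the e^(-At) B is zero: along any
    trajectory of the control system its pairing with e^(-At) x is constant,
    and controllability steers the vector itself to the origin. *)
Lemma controllable_orthogonal (v : 'rV[R]_n) :
  (forall t, v *m E t *m B = 0) -> v = 0.
Proof.
move=> vEB; have [T [u [x [T0 _ cx dx [x0 xT]]]]] := AB v^T 0.
pose z t := (v *m E t *m x t) 0 0.
have dz t : t \in `]0, T[ -> is_derive t 1 z 0.
  rewrite in_itv/= => tT; have hx := dx t tT.
  have hv := is_derive_mulmx (is_derive_cst v t 1) (is_derive_expmx A t).
  have /is_derive_mxP /(_ 0 0) := is_derive_mulmx hv hx.
  congr is_derive; rewrite /cst mul0mx add0r mulmxN mulNmx mulmxDr !mulmxA vEB.
  by rewrite mul0mx addr0 -(mulmxA v A) expmx_comm mulmxA addNr mxE.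
have cz : {within `[0, T], continuous z}.
  move=> s; rewrite /z.
  rewrite (_ : (fun t => _) = fun t => \sum_l (v *m E t) 0 l * x t l 0); last first.
    by apply/funext => t; rewrite mxE.
  rewrite /continuous_at; apply: cvg_sumr => l; apply: cvgM; last first.
    by apply: cvg_coord; exact: cx.
  have cE : continuous (fun t => (v *m E t) 0 l).
    apply: contmx_mull; apply: is_derive_contmx => t; exact: is_derive_expmx.
  exact: (continuous_subspaceT (A := `[0, T]%classic) cE).
have [c _] := MVT_segment (ltW T0) dz cz.
rewrite mul0r /z xT x0 mulmx0 oppr0 expmx0 mulmx1 mxE sub0r => /eqP.
by rewrite oppr_eq0 => /eqP /mulmx_tr_eq0.
Qed.

(** Controllability makes the Gramian invertible: a kernel vector v satisfies
    v e^(-At) B = 0 on ]0, Th[, hence for all t by analyticity. *)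
Lemma gramian_unit : W \in unitmx.
Proof.
rewrite unitmxE unitfE; apply/negP => /det0P[v v0 vW].
move/eqP: v0; apply.
have q0 t : 0 < t < Th -> v *m E t *m B = 0.
  move=> tT; apply: mulmx_tr_eq0.
  apply: (@Rintegral0_continuous _ (fun t => ((v *m E t *m B) *m (v *m E t *m B)^T) 0 0) Th).
  - have c : contmx (fun t => v *m M t *m v^T).
      exact/contmx_mulr/contmx_mull/contmx_gram.
    move=> s; have := c 0 0 s.
    by under eq_fun do rewrite !mulmxA;
       under [X in _ -> continuous_at _ X]eq_fun do rewrite !trmx_mul !mulmxA.
  - by move=> s; exact: mulmx_tr_ge0.
  - by rewrite -gramian_quadE vW mul0mx mxE.
  - exact: tT.
(* Differentiating repeatedly yields the Kalman-type identities v A^k B = 0. *)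
have qk k t : 0 < t < Th -> v *m A ^+ k *m E t *m B = 0.
  elim: k t => [|k IHk] t tT; first by rewrite expr0 -idmxE mulmx1 q0.
  have h1 := is_derive_mulmx (is_derive_mulmx (is_derive_cst (v *m A ^+ k) t 1)
    (is_derive_expmx A t)) (is_derive_cst B t 1).
  have h2 : is_derive t 1 (fun s => v *m A ^+ k *m E s *m B) 0.
    apply: (@near_eq_is_derive _ _ _ (fun=> 0)).
    move/andP: tT => [t0 tT].
    near=> s; rewrite IHk//; apply/andP; split; near: s.
      exact: lt_nbhsr.
    exact: lt_nbhsl.
  have := @derive_val _ _ _ _ _ _ _ h1; rewrite (@derive_val _ _ _ _ _ _ _ h2).
  rewrite /cst mul0mx add0r mulmx0 addr0 mulmxN mulNmx => /eqP.
  by rewrite eq_sym oppr_eq0 exprSr -mulmxE !mulmxA => /eqP.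
have k0 k : v *m A ^+ k *m B = 0.
  apply/matrixP => i j.
  have c : contmx (fun t => v *m A ^+ k *m E t *m B).
    by apply: contmx_mulr; apply: contmx_mull; apply: is_derive_contmx => t;
       exact: is_derive_expmx.
  have : (v *m A ^+ k *m E 0 *m B) i j = 0.
    by apply: (continuous_eq0_right Th0 (c i j)) => t tT; rewrite qk// mxE.
  by rewrite /= oppr0 expmx0 mulmx1 => ->; rewrite mxE.
(* Summing the exponential series extends the identity to all times. *)
apply: controllable_orthogonal => t; apply/matrixP => i j; rewrite [RHS]mxE.
pose s k l := pseries (expcoef (fun r => (A ^+ r) k l)) (- t).
have h : (fun N => \sum_l (\sum_k v i k * s k l N) * B l j) @ \oo -->
    (v *m E t *m B) i j.
  rewrite mxE; apply: cvg_sumr => l; apply: cvgMl; rewrite mxE.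
  apply: cvg_sumr => k; apply: cvgMr; exact: expmx_cvg.
rewrite -(cvg_lim (@Rhausdorff R) h); apply: cvg_lim => //.
rewrite (_ : (fun N => _) = fun=> 0); first exact: cvg_cst.
apply/funext => N.
transitivity (\sum_(0 <= r < N) (r`!%:R)^-1 * (- t) ^+ r * (v *m A ^+ r *m B) i j).
  rewrite /s /pseries /series /=.
  under eq_bigr do under eq_bigr do rewrite mulr_sumr.
  under eq_bigr do rewrite exchange_big mulr_suml.
  rewrite exchange_big; apply: eq_bigr => r _.
  rewrite mxE mulr_sumr; apply: eq_bigr => l _.
  rewrite mxE !mulr_suml mulr_sumr; apply: eq_bigr => k _.
  rewrite /expcoef; ring.
by apply: big1 => r _; rewrite k0 mxE mulr0.
Unshelve. all: by end_near. Qed.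

Lemma invgram_sym : G^T = G.
Proof. by rewrite invgramE trmx_inv gramian_sym. Qed.

Lemma invgram_quadE (x : 'cV[R]_n) :
  x^T *m G *m x = (x^T *m G) *m W *m (x^T *m G)^T.
Proof.
by rewrite trmx_mul trmxK invgram_sym invgramE mulmxKV ?gramian_unit// mulmxA.
Qed.

Lemma invgram_psd (x : 'cV[R]_n) : 0 <= (x^T *m G *m x) 0 0.
Proof. by rewrite invgram_quadE; exact: gramian_psd. Qed.

(** The quadratic form of the inverse Gramian controls every coordinate: expand
    the nonnegative form at x - l W e_k and choose l proportional to x_k. *)
Lemma invgram_coercive :
  exists c, 0 <= c /\ forall (x : 'cV[R]_n) k, x k 0 ^+ 2 <= c * (x^T *m G *m x) 0 0.
Proof.
pose a k := (delta_mx 0 k *m W *m (delta_mx 0 k)^T : 'M[R]_1) 0 0.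
have a0 k : 0 <= a k by exact: gramian_psd.
exists (1 + \sum_k a k); split; first by rewrite addr_ge0// sumr_ge0.
move=> x k; pose q := (x^T *m G *m x) 0 0.
have q0 : 0 <= q := invgram_psd x.
have key l : 0 <= q - 2 * l * x k 0 + l ^+ 2 * a k.
  pose w : 'cV[R]_n := W *m (delta_mx 0 k)^T.
  have Gw : G *m w = (delta_mx 0 k)^T.
    by rewrite invgramE mulKmx// gramian_unit.
  have wG : w^T *m G = delta_mx 0 k.
    by rewrite -invgram_sym -trmx_mul Gw trmxK.
  have := invgram_psd (x - l *: w).
  have -> : (x - l *: w)^T = x^T - l *: w^T by rewrite linearB linearZ.
  rewrite !mulmxBl !mulmxBr -!scalemxAl -!scalemxAr.
  rewrite wG -(mulmxA x^T G w) Gw.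
  have xk : (x^T *m (delta_mx 0 k)^T : 'M[R]_1) 0 0 = x k 0.
    by rewrite -trmx_mul mxE -rowE mxE.
  have xk' : (delta_mx 0 k *m x : 'M[R]_1) 0 0 = x k 0 by rewrite -rowE mxE.
  have wk : (delta_mx 0 k *m w : 'M[R]_1) 0 0 = a k by rewrite /w mulmxA.
  rewrite !mxE; rewrite !mxE in xk xk' wk.
  rewrite xk xk' wk {1}/q !mxE -/q.
  by move=> h; apply: le_trans h _; rewrite le_eqVlt; apply/orP; left; apply/eqP; ring.
have ak1 : 0 < a k + 1 by rewrite ltr_wpDl.
have := key (x k 0 / (a k + 1)); set l := x k 0 / (a k + 1).
have El : x k 0 = l * (a k + 1) by rewrite /l divfK// gt_eqF.
rewrite El => h.
apply: (@le_trans _ _ ((a k + 1) * q)).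
  have l2 : 0 <= l ^+ 2 := sqr_ge0 l.
  have : (a k + 1) * l ^+ 2 <= q by nra.
  nra.
rewrite ler_wpM2r// addrC lerD2l (bigD1 k)//= lerDl.
by apply: sumr_ge0.
Qed.

Lemma invgram_lyapunov :
  G *m A + A^T *m G = G *m B *m B^T *m G -
    G *m expmx (- Th *: A) *m B *m B^T *m (expmx (- Th *: A))^T *m G.
Proof.
have GW : G *m W = 1%:M by rewrite invgramE mulVmx// gramian_unit.
have WG : W *m G = 1%:M by rewrite invgramE mulmxV// gramian_unit.
transitivity (G *m (A *m W + W *m A^T) *m G).
  rewrite mulmxDr mulmxDl; congr (_ + _); last by rewrite !mulmxA GW mul1mx.
  by rewrite -!mulmxA WG mulmx1.
by rewrite gramian_lyapunov mulmxBr mulmxBl !mulmxA.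
Qed.

End Gramian.

(** * Entropic optimal transport *)

(** The summand p (ln p - 1) of the negative entropy. *)
Definition xlnx1 (R : realType) (p : R) : R := p * (ln p - 1).

Lemma ln_le_sub1 (R : realType) (x : R) : 0 < x -> ln x <= x - 1.
Proof.
move=> x0; have := @le_ln1Dx R (x - 1).
by rewrite (_ : 1 + (x - 1) = x); [apply; lra|ring].
Qed.

(** Strong convexity of p (ln p - 1) on [0, 1]. Its Bregman divergence dominates
    (sqrt p - sqrt m)^2, because ln y <= y - 1 at y = sqrt m / sqrt p, and the
    sum of the two square roots is at most 2. *)
Lemma xlnx1_bregman (R : realType) (p m : R) : 0 <= p <= 1 -> 0 < m <= 1 ->
  (p - m) ^+ 2 / 4 <= xlnx1 p - xlnx1 m - ln m * (p - m).
Proof.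
move=> /andP[p0 p1] /andP[m0 m1]; rewrite /xlnx1.
(* At p = 0 the divergence is m itself. *)
move: p0; rewrite le_eqVlt => /predU1P[<-|p0]; first by nra.
pose a := Num.sqrt p; pose b := Num.sqrt m.
have a0 : 0 < a by rewrite sqrtr_gt0.
have b0 : 0 < b by rewrite sqrtr_gt0.
have pE : p = a ^+ 2 by rewrite sqr_sqrtr// ltW.
have mE : m = b ^+ 2 by rewrite sqr_sqrtr// ltW.
have a1 : a <= 1 by rewrite -sqrtr1 ler_wsqrtr.
have b1 : b <= 1 by rewrite -sqrtr1 ler_wsqrtr.
have : ln (b / a) <= b / a - 1 by apply: ln_le_sub1; rewrite divr_gt0.
rewrite ln_div ?posrE// => h.
have {}h : a * (ln b - ln a) <= b - a.
  have -> : b - a = a * (b / a - 1) by rewrite mulrBr mulr1 mulrC divfK// gt_eqF.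
  by rewrite ler_pM2l.
rewrite pE mE !lnXn// !mulr2n.
have h2 : 2 * a * (a * (ln b - ln a)) <= 2 * a * (b - a).
  by rewrite ler_pM2l// mulr_gt0.
have h3 : (a ^+ 2 - b ^+ 2) ^+ 2 / 4 <= (a - b) ^+ 2.
  have -> : (a ^+ 2 - b ^+ 2) ^+ 2 / 4 = (a - b) ^+ 2 * ((a + b) / 2) ^+ 2 by field.
  rewrite -[leRHS]mulr1 ler_wpM2l ?sqr_ge0//.
  by rewrite expr_le1 //; lra.
apply: (le_trans h3); rewrite -subr_ge0.
have -> : a ^+ 2 * (ln a + ln a - 1) - b ^+ 2 * (ln b + ln b - 1) -
   (ln b + ln b) * (a ^+ 2 - b ^+ 2) - (a - b) ^+ 2 =
   2 * a * (b - a) - 2 * a * (a * (ln b - ln a)) by ring.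
by rewrite subr_ge0.
Qed.

Lemma xlnx1_midpoint (R : realType) (p q : R) : 0 <= p <= 1 -> 0 <= q <= 1 ->
  2 * xlnx1 ((p + q) / 2) + (p - q) ^+ 2 / 8 <= xlnx1 p + xlnx1 q.
Proof.
move=> hp hq; have /andP[p0 p1] := hp; have /andP[q0 q1] := hq.
(* A null midpoint forces p = q = 0. *)
have [m0|m0] := ltP 0 ((p + q) / 2); last first.
  have -> : p = 0 by lra.
  have -> : q = 0 by lra.
  rewrite /xlnx1; lra.
have hm : 0 < (p + q) / 2 <= 1 by rewrite m0 /=; lra.
have := xlnx1_bregman hp hm; have := xlnx1_bregman hq hm.
set m := (p + q) / 2; have mE : p + q = 2 * m by rewrite /m; field.
have -> : p = 2 * m - q by rewrite -mE addrK.
set x := xlnx1 _; set y := xlnx1 _; set z := xlnx1 _; set l := ln m.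
nra.
Qed.

Lemma xlnx1_ge (R : realType) (p : R) : 0 <= p <= 1 -> -1 <= xlnx1 p.
Proof.
move=> hp; have h1 : 0 < (1 : R) <= 1 by rewrite ltr01 lexx.
have := xlnx1_bregman hp h1.
have x1 : xlnx1 (1 : R) = -1 by rewrite /xlnx1 ln1; ring.
by have := sqr_ge0 (p - 1); rewrite x1 ln1; lra.
Qed.

(** Continuity on the whole line: at 0 it follows from |x ln x| <= 2 sqrt x on
    ]0, 1[, and ln is constantly 0 on the negative half line. *)
Lemma continuous_xlnx1 (R : realType) : continuous (@xlnx1 R).
Proof.
move=> p; have [p0|p0|->] := ltgtP p 0.
- have h : \forall x \near p, - x = xlnx1 x.
    near=> x; have x0 : x < 0 by near: x; exact: lt_nbhsl.
    by rewrite /xlnx1 ln0 ?ltW// sub0r mulrN1.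
  rewrite /continuous_at -(nbhs_singleton h).
  apply: cvg_trans; first exact: near_eq_cvg h.
  by apply: cvgN; exact: cvg_id.
- apply: cvgM; first exact: cvg_id.
  by apply: cvgB; [exact: continuous_ln|exact: cvg_cst].
- rewrite /continuous_at {2}/xlnx1 mul0r.
  pose g (x : R) := 2 * Num.sqrt `|x| + `|x|.
  have g0 : g x @[x --> 0] --> 0.
    have gE : g 0 = 0 by rewrite /g normr0 sqrtr0 mulr0 addr0.
    rewrite -[X in _ --> X]gE.
    apply: cvgD; last exact: norm_continuous.
    apply: cvgMr; apply: continuous_comp; first exact: norm_continuous.
    exact: sqrt_continuous.
  apply/cvgrPdist_le => e e0.
  have /cvgrPdist_le /(_ e e0) ge := g0.
  near=> x; rewrite sub0r normrN.
  have : `|0 - g x| <= e by near: x.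
  rewrite sub0r normrN [`|g x|]ger0_norm ?addr_ge0 ?mulr_ge0// => gx.
  apply: le_trans gx; rewrite /g /xlnx1.
  have [x0|x0] := leP x 0.
    rewrite ln0// sub0r mulrN1 normrN lerDr mulr_ge0//.
  have x1 : x < 1 by near: x; apply: lt_nbhsl; exact: ltr01.
  rewrite (gtr0_norm x0) mulrBr mulr1.
  apply: (le_trans (ler_normB _ _)); rewrite [`|x|]gtr0_norm// lerD2r.
  have s0 : 0 < Num.sqrt x by rewrite sqrtr_gt0.
  have xE : x = Num.sqrt x ^+ 2 by rewrite sqr_sqrtr// ltW.
  rewrite normrM gtr0_norm// ler0_norm; last by apply: ln_le0; exact: ltW.
  have := @ln_le_sub1 R (Num.sqrt x)^-1; rewrite invr_gt0 => /(_ s0).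
  rewrite lnV ?posrE// => hl.
  have lE : ln x = 2 * ln (Num.sqrt x) by rewrite {1}xE lnXn// mulr_natl.
  rewrite lE {1}xE.
  have h : Num.sqrt x * - ln (Num.sqrt x) <= 1.
    have : Num.sqrt x * - ln (Num.sqrt x) <= Num.sqrt x * (Num.sqrt x)^-1.
      by rewrite ler_pM2l//; lra.
    by rewrite mulfV// gt_eqF.
  nra.
Unshelve. all: by end_near. Qed.

Section EntropicTransport.
Variables (R : realType) (N : nat) (eps : R).
Hypothesis N0 : (0 < N)%N.
Hypothesis eps0 : 0 < eps.
Implicit Types C P Q : 'M[R]_N.

Lemma eot_costE C P : eot_cost eps C P =
  \sum_i \sum_j (C i j * P i j + eps * xlnx1 (P i j)).
Proof.
rewrite /eot_cost /entropy mulrN opprK mulr_sumr -big_split; apply: eq_bigr => i _.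
by rewrite mulr_sumr -big_split.
Qed.

Lemma couplings_row P i : couplings P -> \sum_j P i j = N%:R^-1.
Proof.
case=> _ /matrixP /(_ i 0) + _; rewrite !mxE => <-.
by apply: eq_bigr => j _; rewrite mxE mulr1.
Qed.

Lemma couplings_col P j : couplings P -> \sum_i P i j = N%:R^-1.
Proof.
case=> _ _ /matrixP /(_ j 0); rewrite !mxE => <-.
by apply: eq_bigr => i _; rewrite !mxE mulr1.
Qed.

Lemma couplingsP P : couplings P <-> [/\ forall i j, 0 <= P i j,
  forall i, \sum_j P i j = N%:R^-1 & forall j, \sum_i P i j = N%:R^-1].
Proof.
split=> [cP|[h1 h2 h3]].
  split; first by case: cP.
    by move=> i; exact: couplings_row.
  by move=> j; exact: couplings_col.
split=> //; apply/matrixP => i j; rewrite !mxE.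
  by rewrite -(h2 i); apply: eq_bigr => k _; rewrite mxE mulr1.
by rewrite -(h3 i); apply: eq_bigr => k _; rewrite !mxE mulr1.
Qed.

Lemma couplings_itv P i j : couplings P -> 0 <= P i j <= 1.
Proof.
move=> cP; have [P0 _ _] := cP; rewrite P0 /=.
apply: (@le_trans _ _ (N%:R^-1)).
  rewrite -(couplings_row i cP) (bigD1 j)//= lerDl.
  by apply: sumr_ge0.
by rewrite invf_le1 ?ltr0n// ler1n.
Qed.

Lemma couplings_mid P Q : couplings P -> couplings Q ->
  couplings (2^-1 *: (P + Q)).
Proof.
move=> /couplingsP[P1 P2 P3] /couplingsP[Q1 Q2 Q3]; apply/couplingsP; split.
- by move=> i j; rewrite !mxE mulr_ge0// ?addr_ge0// invr_ge0.
- move=> i; under eq_bigr do rewrite !mxE.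
  by rewrite -mulr_sumr big_split /= P2 Q2; field; rewrite pnatr_eq0 -lt0n.
- move=> i; under eq_bigr do rewrite !mxE.
  by rewrite -mulr_sumr big_split /= P3 Q3; field; rewrite pnatr_eq0 -lt0n.
Qed.

Lemma couplings_nonempty : exists P, couplings P.
Proof.
exists (const_mx (N%:R^-1 * N%:R^-1)); apply/couplingsP; split.
- by move=> i j; rewrite mxE mulr_ge0// invr_ge0.
- move=> i; under eq_bigr do rewrite mxE.
  rewrite sumr_const card_ord -[_ *+ _]mulr_natl mulrA mulfV ?mul1r//.
  by rewrite pnatr_eq0 -lt0n.
- move=> i; under eq_bigr do rewrite mxE.
  rewrite sumr_const card_ord -[_ *+ _]mulr_natl mulrA mulfV ?mul1r//.
  by rewrite pnatr_eq0 -lt0n.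
Qed.

Lemma eot_minimizer_exists C : exists P, eot_minimizer eps C P.
Proof.
pose K := [set v : 'rV[R]_(N * N) | couplings (vec_mx v)].
have cc (i j : 'I_N) : continuous (fun v : 'rV[R]_(N * N) => vec_mx v i j).
  move=> v; have -> : (fun v : 'rV[R]_(N * N) => vec_mx v i j) =
      (fun v => v 0 (mxvec_index i j)) by apply/funext => w; rewrite mxE.
  exact: coord_continuous.
have cr i : continuous (fun v : 'rV[R]_(N * N) => \sum_j vec_mx v i j).
  by move=> v; apply: (@cvg_sumr _ _ _ (nbhs v) _ _ _ _) => j; exact: cc.
have cl j : continuous (fun v : 'rV[R]_(N * N) => \sum_i vec_mx v i j).
  by move=> v; apply: (@cvg_sumr _ _ _ (nbhs v) _ _ _ _) => i; exact: cc.
have cK : compact K.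
  apply: (@subclosed_compact _ _ [set v : 'rV[R]_(N * N) |
      forall k, `[0, 1]%classic (v ord0 k)]).
  - have -> : K = (\bigcap_(ij in [set: 'I_N * 'I_N])
        ((fun v => vec_mx v ij.1 ij.2) @^-1` [set y | 0 <= y])) `&`
        ((\bigcap_(i in [set: 'I_N])
          ((fun v => \sum_j vec_mx v i j) @^-1` [set N%:R^-1])) `&`
        (\bigcap_(j in [set: 'I_N])
          ((fun v => \sum_i vec_mx v i j) @^-1` [set N%:R^-1]))).
      apply/seteqP; split=> v.
        by move=> /couplingsP[h1 h2 h3]; split; [|split] => i _ /=.
      move=> [h1 [h2 h3]]; apply/couplingsP; split=> [i j|i|j].
      - exact: (h1 (i, j)).
      - exact: h2.
      - exact: h3.
    apply: closedI; [|apply: closedI]; apply: closed_bigI => ij _;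
      apply: preimage_closed.
    + by move=> v _; apply: cc.
    + exact: closed_ge.
    + by move=> v _; apply: cr.
    + exact: closed_eq.
    + by move=> v _; apply: cl.
    + exact: closed_eq.
  - apply: (@rV_compact R _ (fun=> `[0, 1]%classic)) => k.
    exact: segment_compact.
  - move=> v hv k /=; rewrite in_itv /=.
    case/mxvec_indexP: k => i j.
    by have := couplings_itv i j hv; rewrite mxE.
have K0 : K !=set0.
  have [P cP] := couplings_nonempty.
  by exists (mxvec P); rewrite /K /= mxvecK.
have cf : {within K, continuous (fun v => eot_cost eps C (vec_mx v))}.
  apply: continuous_subspaceT => v.
  rewrite /continuous_at; under eq_fun do rewrite eot_costE.
  rewrite eot_costE.
  apply: (@cvg_sumr _ _ _ (nbhs v) _ _ _ _) => i.
  apply: (@cvg_sumr _ _ _ (nbhs v) _ _ _ _) => j; apply: cvgD; apply: cvgMr.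
    exact: cc.
  apply: (@continuous_comp _ _ _ (fun v => vec_mx v i j) (@xlnx1 R)).
    exact: cc.
  exact: continuous_xlnx1.
have [v vK hv] := EVT_min_rV K0 cK cf.
exists (vec_mx v); split; first by rewrite inE in vK.
move=> Q cQ; have := hv (mxvec Q); rewrite mxvecK; apply.
by rewrite inE /K /= mxvecK.
Qed.

Lemma eot_planP C : eot_minimizer eps C (eot_plan eps C).
Proof. by have [P hP] := eot_minimizer_exists C; exact: (xgetPex 0 (ex_intro _ P hP)). Qed.

(** Quadratic growth of the cost around its minimizer. *)
Lemma eot_minimizer_gap C P Q : eot_minimizer eps C P -> couplings Q ->
  eps / 8 * \sum_i \sum_j (P i j - Q i j) ^+ 2 <= eot_cost eps C Q - eot_cost eps C P.
Proof.
move=> [cP hP] cQ; have hM := hP _ (couplings_mid cP cQ).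
suff : 2 * eot_cost eps C (2^-1 *: (P + Q)) +
    eps / 8 * \sum_i \sum_j (P i j - Q i j) ^+ 2 <=
    eot_cost eps C P + eot_cost eps C Q by lra.
rewrite !eot_costE !mulr_sumr -!big_split; apply: ler_sum => i _.
rewrite !mulr_sumr -!big_split; apply: ler_sum => j _ /=; rewrite !mxE.
have := xlnx1_midpoint (couplings_itv i j cP) (couplings_itv i j cQ).
rewrite (mulrC 2^-1).
set x := xlnx1 _; set y := xlnx1 _; set z := xlnx1 _.
move=> h; have := ler_wpM2l (ltW eps0) h; lra.
Qed.

(** The optimal plan is a Lipschitz function of the cost, and does not see
    perturbations r of the cost that only depend on the row. *)
Lemma eot_plan_lipschitz C C' (D : 'M[R]_N) (r : 'I_N -> R) (d : R) :
  0 <= d ->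
  (forall i j, C' i j - C i j = D i j + r i) -> (forall i j, `|D i j| <= d) ->
  forall i j, `|eot_plan eps C' i j - eot_plan eps C i j| <=
    4 * N%:R ^+ 2 / eps * d.
Proof.
move=> d0 CD Dd i0 j0.
set P' := eot_plan eps C'; set P := eot_plan eps C.
have mP : eot_minimizer eps C P := eot_planP C.
have mP' : eot_minimizer eps C' P' := eot_planP C'.
have [cP _] := mP; have [cP' _] := mP'.
pose S := \sum_i \sum_j (P i j - P' i j) ^+ 2.
have S'E : \sum_i \sum_j (P' i j - P i j) ^+ 2 = S.
  by apply: eq_bigr => i _; apply: eq_bigr => j _; rewrite -sqrrN opprB.
have h : eps / 4 * S <= \sum_i \sum_j D i j * (P i j - P' i j).
  have h1 := eot_minimizer_gap mP cP'; have h2 := eot_minimizer_gap mP' cP.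
  rewrite S'E -/S in h1 h2.
  have E : \sum_i \sum_j D i j * (P i j - P' i j) =
      (eot_cost eps C P' - eot_cost eps C P) +
      (eot_cost eps C' P - eot_cost eps C' P').
    rewrite !eot_costE -!sumrB -big_split; apply: eq_bigr => i _ /=.
    have r0 : \sum_j r i * (P i j - P' i j) = 0.
      by rewrite -mulr_sumr sumrB !couplings_row// subrr mulr0.
    transitivity (\sum_j (C' i j - C i j) * (P i j - P' i j)).
      under [RHS]eq_bigr do rewrite CD mulrDl.
      by rewrite big_split /= r0 addr0.
    by rewrite -!sumrB -big_split; apply: eq_bigr => j _ /=; ring.
  rewrite E; lra.
have S0 : 0 <= S by apply: sumr_ge0 => i _; apply: sumr_ge0 => j _; exact: sqr_ge0.
pose s := Num.sqrt S.
have sE : S = s ^+ 2 by rewrite sqr_sqrtr.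
have s0 : 0 <= s := sqrtr_ge0 _.
have ds i j : `|P i j - P' i j| <= s.
  rewrite -sqrtr_sqr ler_wsqrtr// /S (bigD1 i)//= (bigD1 j)//= -addrA lerDl.
  apply: addr_ge0; first by apply: sumr_ge0 => l _; exact: sqr_ge0.
  by apply: sumr_ge0 => l _; apply: sumr_ge0 => l' _; exact: sqr_ge0.
have h2 : eps / 4 * s ^+ 2 <= N%:R ^+ 2 * d * s.
  rewrite -sE; apply: (le_trans h).
  have -> : N%:R ^+ 2 * d * s = \sum_(i < N) \sum_(j < N) d * s.
    by rewrite !sumr_const !card_ord -mulrnA -[RHS]mulr_natl natrM; ring.
  apply: ler_sum => i _; apply: ler_sum => j _.
  apply: (le_trans (ler_norm _)); rewrite normrM.
  by apply: ler_pM.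
rewrite distrC; apply: (le_trans (ds i0 j0)).
move: s0; rewrite le_eqVlt => /predU1P[<-|s0].
  by rewrite !mulr_ge0// ?invr_ge0 ?sqr_ge0 ?ltW.
have h3 : eps / 4 * s <= N%:R ^+ 2 * d.
  by move: h2; rewrite [s ^+ 2]expr2 mulrA ler_pM2r.
have -> : 4 * N%:R ^+ 2 / eps * d = (4 / eps) * (N%:R ^+ 2 * d) by ring.
have -> : s = (4 / eps) * (eps / 4 * s) by field; rewrite gt_eqF.
by rewrite ler_pM2l// divr_gt0.
Qed.

(** The optimal value of the transport problem. *)
Definition eot_value C : R := eot_cost eps C (eot_plan eps C).

Lemma eot_value_sub C C' :
  \sum_i \sum_j (C' i j - C i j) * eot_plan eps C' i j <= eot_value C' - eot_value C
  <= \sum_i \sum_j (C' i j - C i j) * eot_plan eps C i j.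
Proof.
rewrite /eot_value; have [cP hP] := eot_planP C; have [cP' hP'] := eot_planP C'.
set P := eot_plan eps C in cP hP *; set P' := eot_plan eps C' in cP' hP' *.
have E Q : eot_cost eps C' Q - eot_cost eps C Q =
    \sum_i \sum_j (C' i j - C i j) * Q i j.
  rewrite !eot_costE -sumrB; apply: eq_bigr => i _; rewrite -sumrB.
  by apply: eq_bigr => j _; ring.
rewrite -!E; have := hP _ cP'; have := hP' _ cP => h1 h2.
apply/andP; split; lra.
Qed.

Lemma eot_value_ge C :
  \sum_i \sum_j C i j * eot_plan eps C i j - eps * N%:R ^+ 2 <= eot_value C.
Proof.
rewrite /eot_value eot_costE; have [cP _] := eot_planP C.
have -> : eps * N%:R ^+ 2 = \sum_(i < N) \sum_(j < N) eps.
  by rewrite !sumr_const !card_ord -mulrnA -[RHS]mulr_natl natrM; ring.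
rewrite -sumrB; apply: ler_sum => i _; rewrite -sumrB; apply: ler_sum => j _.
rewrite lerD2l -[- eps]mulrN1 ler_pM2l//; apply: xlnx1_ge.
exact: couplings_itv.
Qed.

End EntropicTransport.

(** * Limit sets of curves and LaSalle's principle *)

Lemma coord_le_norm (R : realType) (k : nat) (v : 'cV[R]_k) i : `|v i 0| <= `|v|.
Proof.
rewrite [leRHS]/Num.Def.normr/= mx_normrE.
exact: (le_bigmax _ (fun ij : 'I_k * 'I_1 => `|v ij.1 ij.2|) (i, 0)).
Qed.

Lemma norm_le_coord (R : realType) (k : nat) (v : 'cV[R]_k) (c : R) :
  0 <= c -> (forall i, `|v i 0| <= c) -> `|v| <= c.
Proof.
move=> c0 h; rewrite [leLHS]/Num.Def.normr/= mx_normrE.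
by apply: bigmax_le => //= -[i j] _ /=; rewrite (ord1 j).
Qed.

Lemma sqr_norm_le_sum (R : realType) (k : nat) (v : 'cV[R]_k) :
  `|v| ^+ 2 <= \sum_i v i 0 ^+ 2.
Proof.
set S := \sum_i _; have S0 : 0 <= S by apply: sumr_ge0 => i _; exact: sqr_ge0.
have : `|v| <= Num.sqrt S.
  apply: norm_le_coord; first exact: sqrtr_ge0.
  move=> i; rewrite -sqrtr_sqr ler_wsqrtr// /S (bigD1 i)//= lerDl.
  by apply: sumr_ge0 => j _; exact: sqr_ge0.
move=> h; rewrite -[S]sqr_sqrtr// ler_sqr// nnegrE// sqrtr_ge0.
Qed.

Lemma sum_le_sqr_norm (R : realType) (k : nat) (v : 'cV[R]_k) :
  \sum_i v i 0 ^+ 2 <= k%:R * `|v| ^+ 2.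
Proof.
rewrite mulr_natl -[k in _ *+ k]card_ord -sumr_const.
apply: ler_sum => i _; rewrite -real_normK ?num_real// ler_sqr ?nnegrE//.
exact: coord_le_norm.
Qed.

Lemma enormE (R : realType) (k : nat) (v : 'cV[R]_k) :
  enorm v = Num.sqrt (\sum_i v i 0 ^+ 2).
Proof.
rewrite /enorm /wnorm mulmx1 mxE; congr Num.sqrt.
by apply: eq_bigr => i _; rewrite mxE.
Qed.

Lemma enorm_ge0 (R : realType) (k : nat) (v : 'cV[R]_k) : 0 <= enorm v.
Proof. exact: sqrtr_ge0. Qed.

Lemma enorm_le (R : realType) (k : nat) (v : 'cV[R]_k) :
  enorm v <= k.+1%:R * `|v|.
Proof.
have h : 0 <= k.+1%:R * `|v| by rewrite mulr_ge0.
rewrite enormE -[leRHS]ger0_norm// -sqrtr_sqr ler_wsqrtr//.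
apply: (le_trans (sum_le_sqr_norm v)); rewrite exprMn ler_wpM2r ?sqr_ge0//.
by rewrite -natrX ler_nat (leq_trans (leqnSn k))// leq_pmulr.
Qed.

(** The set of limit points of a curve as time tends to infinity. *)
Definition limit_set (R : realType) (k : nat) (x : R -> 'cV[R]_k) : set 'cV[R]_k :=
  [set p | forall e T : R, 0 < e -> exists t, T <= t /\ `|x t - p| < e].

(** Comparison of two solutions of the same Lipschitz equation, one of them up
    to an error of size d. *)
Lemma solution_compare (R : realType) (k : nat) (f : 'cV[R]_k -> 'cV[R]_k)
    (L : R) (x y dx dy : R -> 'cV[R]_k) (s d : R) :
  0 <= L -> 0 <= d ->
  (forall u v, `|f u - f v| <= L * `|u - v|) ->
  (forall t : R, `|t| <= `|s| -> is_derive t 1 x (dx t)) ->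
  (forall t : R, `|t| <= `|s| -> is_derive t 1 y (dy t)) ->
  (forall t : R, `|t| <= `|s| -> `|dx t - f (x t)| <= d) ->
  (forall t : R, `|t| <= `|s| -> dy t = f (y t)) ->
  `|x s - y s| ^+ 2 <= (k%:R * `|x 0 - y 0| ^+ 2 + 2 * k%:R * d ^+ 2) *
    expR ((1 + 2 * k%:R * L ^+ 2) * `|s|).
Proof.
move=> L0 d0 fL hx hy hd hdy.
pose z t i := x t i 0 - y t i 0.
pose g t := \sum_i z t i ^+ 2.
pose dg t := \sum_i 2 * z t i * (dx t i 0 - dy t i 0).
have gE t : g t = \sum_i (x t - y t) i 0 ^+ 2.
  by apply: eq_bigr => i _; rewrite !mxE.
have zg t : `|x t - y t| ^+ 2 <= g t by rewrite gE; exact: sqr_norm_le_sum.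
have hg (t : R) : `|t| <= `|s| -> is_derive t 1 g (dg t).
  move=> ts; apply: is_derive_bigsum => i.
  have /is_derive_mxP /(_ i 0) hxi := hx t ts.
  have /is_derive_mxP /(_ i 0) hyi := hy t ts.
  have hz : is_derive t 1 (fun r => z r i) (dx t i 0 - dy t i 0).
    exact: is_deriveB.
  have := is_derive_mul hz hz.
  by congr is_derive; rewrite /z; ring.
have hdg t : `|t| <= `|s| ->
    `|dg t| <= (1 + 2 * k%:R * L ^+ 2) * g t + 2 * k%:R * d ^+ 2.
  move=> ts; apply: (@le_trans _ _ (\sum_i (z t i ^+ 2 +
      (2 * L ^+ 2 * g t + 2 * d ^+ 2)))); last first.
    rewrite big_split /= sumr_const card_ord -mulr_natl -/(g t).
    by rewrite le_eqVlt; apply/orP; left; apply/eqP; ring.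
  apply: (le_trans (ler_norm_sum _ _ _)); apply: ler_sum => i _.
  set w := dx t i 0 - dy t i 0.
  have w1 : `|w| <= L * `|x t - y t| + d.
    have -> : w = (f (x t) - f (y t)) i 0 + (dx t - f (x t)) i 0.
      by rewrite /w hdy// !mxE; ring.
    apply: (le_trans (ler_normD _ _)); apply: lerD.
      exact: le_trans (coord_le_norm _ _) (fL _ _).
    exact: le_trans (coord_le_norm _ _) (hd t ts).
  have := zg t; have : `|2 * z t i * w| <= z t i ^+ 2 + `|w| ^+ 2.
    rewrite real_normK ?num_real// ler_norml; apply/andP; split.
      have := sqr_ge0 (z t i + w); nra.
    have := sqr_ge0 (z t i - w); nra.
  have w0 := normr_ge0 w; have n0 := normr_ge0 (x t - y t).
  set a := `|w| in w1 w0 *; set b := `|x t - y t| in w1 n0 *.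
  move=> h1 h2; apply: (le_trans h1); rewrite lerD2l.
  apply: (@le_trans _ _ ((L * b + d) ^+ 2)).
    by rewrite ler_sqr// nnegrE// (le_trans w0).
  have : (L * b + d) ^+ 2 <= 2 * (L * b) ^+ 2 + 2 * d ^+ 2.
    have := sqr_ge0 (L * b - d); nra.
  move=> h3; apply: (le_trans h3); rewrite lerD2r exprMn mulrA ler_wpM2l//.
  by rewrite mulr_ge0// sqr_ge0.
have c1 : 1 <= 1 + 2 * k%:R * L ^+ 2 by rewrite lerDl !mulr_ge0// sqr_ge0.
have b0 : 0 <= 2 * k%:R * d ^+ 2 by rewrite !mulr_ge0// sqr_ge0.
apply: (le_trans (zg s)); apply: (le_trans (gronwall2 c1 b0 hg hdg)).
rewrite ler_wpM2r ?expR_ge0// lerD2r gE.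
exact: sum_le_sqr_norm.
Qed.

Section LimitSet.
Variables (R : realType) (k : nat) (f : 'cV[R]_k -> 'cV[R]_k) (L : R).
Hypothesis L0 : 0 <= L.
Hypothesis fL : forall u v, `|f u - f v| <= L * `|u - v|.
Variables (x dx : R -> 'cV[R]_k) (a : R).
Hypothesis hx : forall t : R, a <= t -> is_derive t 1 x (dx t).
Hypothesis hdx : forall e : R, 0 < e ->
  exists T, forall t, T <= t -> `|dx t - f (x t)| <= e.

(** The limit set is invariant: over a bounded time span, a trajectory issued
    from a limit point is shadowed by late portions of the curve. *)
Lemma limit_set_invariant : invariant_set f (limit_set x).
Proof.
move=> y hy y0 s e T e0.
(* c exceeds the amplification factor in the comparison of solutions, hence an
   error of size d = e / c at both places is small enough. *)
pose c := (k%:R + 2 * k%:R) * expR ((1 + 2 * k%:R * L ^+ 2) * `|s|) + 1.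
have c0 : 0 < c by rewrite ltr_wpDl// mulr_ge0// expR_ge0.
pose d := e / c; have d0 : 0 < d by rewrite divr_gt0.
have [T1 hT1] := hdx d0.
pose T2 := Num.max (Num.max T T1) a + `|s|.
have [t0 [Tt0 xt0]] := y0 d T2 d0.
have big t : `|t| <= `|s| -> [/\ T <= t0 + t, T1 <= t0 + t & a <= t0 + t].
  rewrite ler_norml => /andP[ts _].
  have : Num.max (Num.max T T1) a <= t0 + t.
    by rewrite -(lerD2r `|s|) (le_trans Tt0)// -addrA lerDl -lerBlDr sub0r.
  by rewrite !ge_max => /andP[/andP[-> ->] ->].
exists (t0 + s); split; first by have [] := big s (lexx _).
have sh (t : R) : `|t| <= `|s| -> is_derive t 1 (fun r => x (t0 + r)) (dx (t0 + t)).
  move=> /big[_ _ at0]; apply/is_derive_mxP => i j.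
  have /is_derive_mxP /(_ i j) := hx at0.
  move=> h; have h1 : is_derive (t0 + 1 * t) 1 (fun r => x r i j) (dx (t0 + t) i j).
    by rewrite mul1r.
  have := is_derive_affine h1; rewrite mul1r.
  by under eq_fun do rewrite mul1r.
have := @solution_compare R k f L (fun r => x (t0 + r)) y (fun r => dx (t0 + r))
  (fun r => f (y r)) s d L0 (ltW d0) fL sh.
move=> /(_ (fun t _ => hy t)) /=.
move=> /(_ (fun t ts => hT1 _ (let: And3 _ h _ := big t ts in h))).
move=> /(_ (fun _ _ => erefl)) h.
rewrite -ltr_sqr ?nnegrE ?(ltW e0)//.
apply: (le_lt_trans h).
have ec : e = d * c by rewrite /d divfK// gt_eqF.
clearbody d; rewrite addr0; have x2 : `|x t0 - y 0| ^+ 2 <= d ^+ 2.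
  by rewrite ler_sqr ?nnegrE// ltW.
set E := expR _; have E0 : 0 <= E by exact: expR_ge0.
have c1 : c <= c ^+ 2.
  by rewrite expr2 ler_peMl ?(ltW c0)// /c lerDr mulr_ge0// expR_ge0.
apply: (@le_lt_trans _ _ (d ^+ 2 * (c - 1))).
  rewrite /c addrK mulrA ler_wpM2r// -/E mulrDr lerD//.
    by rewrite mulrC ler_wpM2r.
  by rewrite mulrC.
rewrite ec exprMn ltr_pM2l ?exprn_gt0//; apply: lt_le_trans c1.
by rewrite ltrBlDr ltrDl.
Qed.

Hypothesis xbd : exists C, forall t, a <= t -> `|x t| <= C.

(** A bounded curve approaches its limit set. *)
Lemma limit_set_attracts (e : R) : 0 < e ->
  exists T, forall t, T <= t -> exists p, limit_set x p /\ `|x t - p| < e.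
Proof.
move=> e0; have [C hC] := xbd.
apply: contrapT => /forallNP H.
pose D := [set t : R | a <= t /\ forall p, limit_set x p -> e <= `|x t - p|].
have DT T : exists t, D t /\ T <= t.
  have /existsNP[t /not_implyP[Tt /forallNP ht]] := H (Num.max a T).
  move: Tt; rewrite ge_max => /andP[at_ Tt].
  exists t; split=> //; split=> // p hp; rewrite leNgt; apply/negP => pe.
  by apply: (ht p).
pose F : set_system R := within D +oo.
have FF : ProperFilter F.
  apply: Build_ProperFilter_ex => A [M [_ hM]].
  have [t [Dt Mt]] := DT (M + 1).
  by exists t; apply: hM => //; apply: lt_le_trans Mt; rewrite ltrDl.
have cB : compact [set v : 'rV[R]_k | forall i, `[- C, C]%classic (v ord0 i)].
  by apply: (@rV_compact R k (fun=> `[- C, C]%classic)) => i; exact: segment_compact.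
have FB : ((fun t => (x t)^T) @ F) [set v : 'rV[R]_k | forall i, `[- C, C]%classic (v ord0 i)].
  apply: (@filterS _ +oo _ (fun t => True)) => [t _ [at_ _] i|].
    rewrite /= in_itv /= mxE -ler_norml.
    exact: le_trans (coord_le_norm _ _) (hC t at_).
  exact: filterT.
have [q [_ hq]] := cB _ (fmap_proper_filter _ FF) FB.
have near_q r T : 0 < r -> exists t, [/\ D t, T <= t & `|x t - q^T| < r].
  move=> r0.
  have [v [[t [Dt Tt] <-] qv]] : exists v,
      ((fun t => (x t)^T) @` [set t | D t /\ T <= t] `&` ball q r) v.
    apply: hq; last exact: nbhsx_ballx.
    exists T; split; first exact: num_real.
    by move=> t Tt Dt; exists t => //; split => //; exact: ltW.
  exists t; split=> //.
  move: qv; rewrite -ball_normE /= distrC.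
  have -> : x t - q^T = ((x t)^T - q)^T by rewrite linearB /= trmxK.
  move=> h; apply: le_lt_trans h; apply: norm_le_coord => // i.
  rewrite mxE [leRHS]/Num.Def.normr/= mx_normrE.
  exact: (le_bigmax _ (fun ij : 'I_1 * 'I_k => `|((x t)^T - q) ij.1 ij.2|) (0, i)).
have qL : limit_set x q^T.
  by move=> r T r0; have [t [_ Tt xr]] := near_q r T r0; exists t.
have [t [[_ hD] _ xq]] := near_q e 0 e0.
by have := hD _ qL; rewrite leNgt xq.
Qed.

(** A form of LaSalle's invariance principle, for a curve that solves the
    Lipschitz equation up to an error vanishing at infinity. *)
Lemma converges_to_largest_invariant (K : set 'cV[R]_k) :
  limit_set x `<=` K -> converges_to_set x (largest_invariant f K).
Proof.
move=> xK; apply/fine_cvgP; split; rewrite /=.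
  have [T hT] := limit_set_attracts ltr01.
  exists T; split; first exact: num_real.
  move=> t /ltW /hT[p [pL _]].
  rewrite fin_numElt; apply/andP; split.
    apply: lt_le_trans (_ : 0 <= _)%E; first exact: ltNyr.
    by apply: le_ereal_inf_tmp => _ [y _ <-]; rewrite lee_fin enorm_ge0.
  apply: (@le_lt_trans _ _ (enorm (x t - p))%:E); last exact: ltry.
  apply: ereal_inf_lbound; exists p => //.
  by exists (limit_set x) => //; split => //; exact: limit_set_invariant.
apply/cvgrPdist_le => e e0.
have e1 : 0 < e / k.+1%:R by rewrite divr_gt0.
have [T hT] := limit_set_attracts e1.
exists T; split; first exact: num_real.
move=> t /ltW /hT[p [pL pe]]; rewrite /= sub0r normrN.
set I := ereal_inf _.
have I0 : (0 <= I)%E.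
  by apply: le_ereal_inf_tmp => _ [y _ <-]; rewrite lee_fin enorm_ge0.
have I1 : (I <= (enorm (x t - p))%:E)%E.
  apply: ereal_inf_lbound; exists p => //.
  by exists (limit_set x) => //; split => //; exact: limit_set_invariant.
rewrite ger0_norm ?fine_ge0//.
rewrite -lee_fin fineK; last first.
  by rewrite ge0_fin_numE// (le_lt_trans I1)// ltry.
apply: (le_trans I1); rewrite lee_fin.
apply: (le_trans (enorm_le _)).
by rewrite mulrC -ler_pdivlMr// ltW.
Qed.

End LimitSet.

(** * Lipschitz functions on a space of column vectors *)

(** Global Lipschitz continuity of a scalar function for the sup norm, with an
    existentially quantified constant. *)
Definition lipfun (R : realType) (k : nat) (h : 'cV[R]_k -> R) : Prop :=
  exists L, 0 <= L /\ forall u v, `|h u - h v| <= L * `|u - v|.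

Lemma eq_lipfun (R : realType) (k : nat) (g h : 'cV[R]_k -> R) :
  (forall u, g u = h u) -> lipfun h -> lipfun g.
Proof. by move=> gh; rewrite (_ : g = h)//; apply/funext. Qed.

Lemma lipfun_cst (R : realType) (k : nat) (c : R) : lipfun (fun _ : 'cV[R]_k => c).
Proof. by exists 0; split=> // u v; rewrite subrr normr0 mul0r. Qed.

Lemma lipfun_coord (R : realType) (k : nat) (i : 'I_k) :
  lipfun (fun u : 'cV[R]_k => u i 0).
Proof.
exists 1; split=> // u v; rewrite mul1r.
by have := coord_le_norm (u - v) i; rewrite !mxE.
Qed.

Lemma lipfunD (R : realType) (k : nat) (g h : 'cV[R]_k -> R) :
  lipfun g -> lipfun h -> lipfun (fun u => g u + h u).
Proof.
move=> [L [L0 gL]] [M [M0 hM]]; exists (L + M); split; first exact: addr_ge0.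
move=> u v; rewrite opprD addrACA mulrDl; apply: (le_trans (ler_normD _ _)).
by rewrite lerD.
Qed.

Lemma lipfunZ (R : realType) (k : nat) (c : R) (h : 'cV[R]_k -> R) :
  lipfun h -> lipfun (fun u => c * h u).
Proof.
move=> [L [L0 hL]]; exists (`|c| * L); split; first exact: mulr_ge0.
by move=> u v; rewrite -mulrBr normrM -mulrA ler_wpM2l.
Qed.

Lemma lipfun_sum (R : realType) (k : nat) (I : Type) (r : seq I)
    (h : I -> 'cV[R]_k -> R) :
  (forall i, lipfun (h i)) -> lipfun (fun u => \sum_(i <- r) h i u).
Proof.
move=> hh; elim: r => [|i r IHr].
  by under eq_fun do rewrite big_nil; exact: lipfun_cst.
by under eq_fun do rewrite big_cons; exact: lipfunD.
Qed.

(** The coordinates of a linear image of Lipschitz coordinates are Lipschitz. *)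
Lemma lipfun_mulmx (R : realType) (k p q : nat) (M : 'M[R]_(p, q))
    (h : 'cV[R]_k -> 'cV[R]_q) :
  (forall j, lipfun (fun u => h u j 0)) ->
  forall i, lipfun (fun u => (M *m h u) i 0).
Proof.
move=> hh i; under eq_fun do rewrite mxE.
by apply: lipfun_sum => j; exact: lipfunZ.
Qed.

(** A finite family of Lipschitz functions has a common constant. *)
Lemma lipfun_common (R : realType) (k : nat) (I : finType) (h : I -> 'cV[R]_k -> R) :
  (forall i, lipfun (h i)) ->
  exists L, 0 <= L /\ forall i u v, `|h i u - h i v| <= L * `|u - v|.
Proof.
move=> /choice[L hL]; exists (\sum_i L i).
have L0 i : 0 <= L i by case: (hL i).
split; first exact: sumr_ge0.
move=> i u v; apply: (le_trans ((hL i).2 u v)).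
by rewrite ler_wpM2r// (bigD1 i)//= lerDl sumr_ge0.
Qed.

Lemma lipfun_norm (R : realType) (k l : nat) (f : 'cV[R]_k -> 'cV[R]_l) :
  (forall i, lipfun (fun u => f u i 0)) ->
  exists L, 0 <= L /\ forall u v, `|f u - f v| <= L * `|u - v|.
Proof.
move=> /lipfun_common[L [L0 hL]]; exists L; split=> // u v.
apply: norm_le_coord; first exact: mulr_ge0.
by move=> i; rewrite !mxE; exact: hL.
Qed.

(** Lipschitz continuity in time on a half line. *)
Definition liptime (R : realType) (a : R) (g : R -> R) : Prop :=
  exists K, forall s t, a <= s -> s <= t -> `|g t - g s| <= K * (t - s).

Lemma liptimeZ (R : realType) (a c : R) (g : R -> R) :
  liptime a g -> liptime a (fun t => c * g t).
Proof.
move=> [K hK]; exists (`|c| * K) => s t as_ st.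
by rewrite -mulrBr normrM -mulrA ler_wpM2l// hK.
Qed.

Lemma liptimeD (R : realType) (a : R) (g h : R -> R) :
  liptime a g -> liptime a h -> liptime a (fun t => g t + h t).
Proof.
move=> [K hK] [L hL]; exists (K + L) => s t as_ st.
rewrite opprD addrACA mulrDl; apply: (le_trans (ler_normD _ _)).
by rewrite lerD ?hK ?hL.
Qed.

Lemma liptime_sum (R : realType) (a : R) (I : Type) (r : seq I) (g : I -> R -> R) :
  (forall i, liptime a (g i)) -> liptime a (fun t => \sum_(i <- r) g i t).
Proof.
move=> hg; elim: r => [|i r IHr].
  under eq_fun do rewrite big_nil.
  by exists 0 => s t _ _; rewrite subrr normr0 mul0r.
by under eq_fun do rewrite big_cons; exact: liptimeD.
Qed.

Lemma liptime_sqr (R : realType) (a C : R) (g : R -> R) :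
  (forall t, a <= t -> `|g t| <= C) -> liptime a g -> liptime a (fun t => g t ^+ 2).
Proof.
move=> gC [K hK]; exists (K * (2 * C)) => s t as_ st.
have at_ := le_trans as_ st.
rewrite subr_sqr normrM mulrAC; apply: ler_pM => //; first exact: hK.
apply: (le_trans (ler_normD _ _)); have := gC s as_; have := gC t at_; lra.
Qed.

(** A Lipschitz function along a bounded curve is bounded. *)
Lemma lipfun_bounded (R : realType) (k : nat) (h : 'cV[R]_k -> R)
    (x : R -> 'cV[R]_k) (a C : R) :
  lipfun h -> (forall t, a <= t -> `|x t| <= C) ->
  exists M, forall t, a <= t -> `|h (x t)| <= M.
Proof.
move=> [L [L0 hL]] xC; exists (L * C + `|h 0|) => t at_.
have -> : h (x t) = (h (x t) - h 0) + h 0 by rewrite subrK.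
apply: (le_trans (ler_normD _ _)); rewrite lerD2r.
apply: (le_trans (hL _ _)); rewrite subr0 ler_wpM2l//; exact: xC.
Qed.

(** A curve of bounded speed is Lipschitz in time. *)
Lemma liptime_derive (R : realType) (a M : R) (g dg : R -> R) :
  (forall t, a <= t -> is_derive t 1 g (dg t)) ->
  (forall t, a <= t -> `|dg t| <= M) -> liptime a g.
Proof.
move=> hg hM; exists M => s t as_; rewrite le_eqVlt => /predU1P[->|st].
  by rewrite !subrr normr0 mulr0.
have [u /andP[su _]|u [/andP[su _] ->]] := mean_value (f := g) (df := dg) st.
  by apply: hg; exact: le_trans su.
have ts0 : 0 <= t - s by rewrite subr_ge0 ltW.
rewrite normrM (ger0_norm ts0) ler_wpM2r//; apply: hM.
exact: le_trans as_ (ltW su).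
Qed.

Lemma liptime_comp (R : realType) (k : nat) (h : 'cV[R]_k -> R)
    (x : R -> 'cV[R]_k) (a : R) :
  lipfun h -> (forall i, liptime a (fun t => x t i 0)) ->
  liptime a (fun t => h (x t)).
Proof.
move=> [L [L0 hL]] /choice[K hK].
exists (L * \sum_i `|K i|) => s t as_ st.
apply: (le_trans (hL _ _)); rewrite -mulrA ler_wpM2l//.
have ts0 : 0 <= t - s by rewrite subr_ge0.
apply: norm_le_coord; first by rewrite mulr_ge0// sumr_ge0.
move=> i; rewrite !mxE; apply: (le_trans (hK i s t as_ st)).
rewrite ler_wpM2r// (le_trans (ler_norm _))// (bigD1 i)//= lerDl.
by apply: sumr_ge0.
Qed.

(** * The optimal transport cost as a Lyapunov function *)

Section ClosedLoop.
Variables (R : realType) (N n m : nat) (Th eps : R).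
Variables (A : 'I_N -> 'M[R]_n) (B : 'I_N -> 'M[R]_(n, m)).
Variable xd : 'I_N -> 'cV[R]_n.
Hypothesis N0 : (0 < N)%N.
Hypothesis Th0 : 0 < Th.
Hypothesis eps0 : 0 < eps.
Hypothesis hctrl : forall i, controllable (A i) (B i).

Local Notation G := (gram Th A B).
Local Notation P := (Pstar Th eps A B xd).
Local Notation dev := (deviation Th eps A B xd).
Local Notation F := (closed_loop Th eps A B xd).
Local Notation C := (ot_cost Th A B xd).
Implicit Types x y : stacked R N n.

(** The value v^T M w of a bilinear form. *)
Definition quad (M : 'M[R]_n) (v w : 'cV[R]_n) : R := (v^T *m M *m w) 0 0.

Lemma gram_sym i : (G i)^T = G i.
Proof. exact: invgram_sym. Qed.

Lemma gram_psd i v : 0 <= quad (G i) v v.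
Proof. exact: invgram_psd. Qed.

Lemma quadC i v w : quad (G i) v w = quad (G i) w v.
Proof.
rewrite /quad -[in RHS](trmxK (_ *m _)) [RHS]mxE.
by rewrite !trmx_mul trmxK gram_sym mulmxA.
Qed.

Lemma quadDl M u v w : quad M (u + v) w = quad M u w + quad M v w.
Proof. by rewrite /quad linearD !mulmxDl mxE. Qed.

Lemma quadDr M u v w : quad M u (v + w) = quad M u v + quad M u w.
Proof. by rewrite /quad mulmxDr mxE. Qed.

Lemma quadZl M c v w : quad M (c *: v) w = c * quad M v w.
Proof. by rewrite /quad linearZ -!scalemxAl mxE. Qed.

Lemma quadNl M v w : quad M (- v) w = - quad M v w.
Proof. by rewrite -scaleN1r quadZl mulN1r. Qed.

Lemma quadNr M v w : quad M v (- w) = - quad M v w.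
Proof. by rewrite /quad mulmxN mxE. Qed.

Lemma quad_suml M (I : Type) (r : seq I) (v : I -> 'cV[R]_n) w :
  quad M (\sum_(i <- r) v i) w = \sum_(i <- r) quad M (v i) w.
Proof.
elim: r => [|i r IHr]; first by rewrite !big_nil /quad trmx0 !mul0mx mxE.
by rewrite !big_cons quadDl IHr.
Qed.

Lemma ot_costE x i j : C x i j = quad (G i) (block x i - xd j) (block x i - xd j).
Proof. by rewrite mxE /wnorm sqr_sqrtr//; exact: gram_psd. Qed.

Lemma couplings_Pstar x : couplings (P x).
Proof. by have [] := eot_planP eps N0 (C x). Qed.

Lemma block_coord x i k : block x i k 0 = x (tagnat.Rank i k) 0.
Proof. by rewrite mxE. Qed.

Lemma lipfun_block i k : lipfun (fun x : stacked R N n => block x i k 0).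
Proof. by apply: (eq_lipfun (fun x => block_coord x i k)); exact: lipfun_coord. Qed.

(** The part of the cost that is quadratic in x depends on the row only, so that
    the optimal plan depends on the state through a cost linear in x. *)
Lemma lipfun_Pstar i j : lipfun (fun x => P x i j).
Proof.
pose h (ij : 'I_N * 'I_N) (x : stacked R N n) :=
  -2 * (((xd ij.2)^T *m G ij.1) *m block x ij.1) 0 0.
have [L [L0 hL]] : exists L, 0 <= L /\ forall ij u v, `|h ij u - h ij v| <= L * `|u - v|.
  apply: lipfun_common => ij; apply: lipfunZ; apply: lipfun_mulmx => k.
  exact: lipfun_block.
exists (4 * N%:R ^+ 2 / eps * L); split.
  by rewrite !mulr_ge0// ?invr_ge0 ?sqr_ge0 ?ltW.
move=> u v; rewrite -[leRHS]mulrA.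
apply: (@eot_plan_lipschitz R N eps N0 eps0 (C v) (C u)
  (\matrix_(i, j) (h (i, j) u - h (i, j) v))
  (fun i => quad (G i) (block u i) (block u i) - quad (G i) (block v i) (block v i))).
- by rewrite mulr_ge0.
- move=> i' j'; rewrite !ot_costE mxE /h /= -!/(quad _ _ _).
  rewrite !(quadDl, quadDr, quadNl, quadNr).
  rewrite ![quad _ (xd j') (block _ _)]quadC.
  ring.
- by move=> i' j'; rewrite mxE; exact: hL.
Qed.

Lemma deviation_coord x i k :
  dev x i k 0 = block x i k 0 - N%:R * \sum_j P x i j * xd j k 0.
Proof.
rewrite !mxE; congr (_ - _ * _); rewrite summxE.
by apply: eq_bigr => j _; rewrite mxE.
Qed.

Lemma lipfun_deviation i k : lipfun (fun x => dev x i k 0).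
Proof.
apply: (@eq_lipfun _ _ _ (fun x => block x i k 0 +
  (- N%:R) * \sum_j P x i j * xd j k 0)).
  by move=> x; rewrite deviation_coord mulNr.
apply: lipfunD; first exact: lipfun_block.
apply: lipfunZ; apply: lipfun_sum => j.
apply: (@eq_lipfun _ _ _ (fun x => xd j k 0 * P x i j)).
  by move=> x; rewrite mulrC.
by apply: lipfunZ; exact: lipfun_Pstar.
Qed.

Lemma lipfun_mul_deviation p (M : 'M[R]_(p, n)) i k :
  lipfun (fun x => (M *m dev x i) k 0).
Proof. by apply: lipfun_mulmx => l; exact: lipfun_deviation. Qed.

Lemma lipfun_drift s : lipfun (fun x => drift Th eps A B xd x s 0).
Proof.
apply: (eq_lipfun (fun x => mxE _ _ _ _)); exact: lipfun_mul_deviation.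
Qed.

Lemma lipfun_closed_loop s : lipfun (fun x => F x s 0).
Proof.
apply: (eq_lipfun (fun x => mxE _ _ _ _)); exact: lipfun_mul_deviation.
Qed.

(** The dissipation rate, a sum of squares that vanishes exactly on Mset. *)
Definition dissipation x : R := N%:R^-1 * \sum_i
  (\sum_l ((B i)^T *m G i *m dev x i) l 0 ^+ 2 +
   \sum_l ((B i)^T *m expmx (- Th *: (A i)^T) *m G i *m dev x i) l 0 ^+ 2).

Lemma dissipation_ge0 x : 0 <= dissipation x.
Proof.
rewrite mulr_ge0 ?invr_ge0// sumr_ge0// => i _.
by apply: addr_ge0; apply: sumr_ge0 => l _; exact: sqr_ge0.
Qed.

Lemma sum_sqrE p (v : 'cV[R]_p) : \sum_l v l 0 ^+ 2 = (v^T *m v) 0 0.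
Proof. by rewrite mxE; apply: eq_bigr => l _; rewrite mxE. Qed.

(** The Lyapunov equation of the Gramian turns the decrease of the quadratic
    form along the closed loop into a sum of two squares. *)
Lemma quad_closed_loop i (d : 'cV[R]_n) :
  2 * quad (G i) d ((A i - B i *m (B i)^T *m G i) *m d) =
  - (\sum_l ((B i)^T *m G i *m d) l 0 ^+ 2 +
     \sum_l ((B i)^T *m expmx (- Th *: (A i)^T) *m G i *m d) l 0 ^+ 2).
Proof.
rewrite !sum_sqrE !trmx_mul !trmxK gram_sym expmx_tr trmxK.
have lyap := @invgram_lyapunov R n m Th (A i) (B i) Th0 (hctrl i).
rewrite -/(G i) in lyap.
have qA : quad (G i) d (A i *m d) = (d^T *m ((A i)^T *m G i) *m d) 0 0.
  by rewrite quadC /quad trmx_mul !mulmxA.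
have -> : quad (G i) d ((A i - B i *m (B i)^T *m G i) *m d) =
    quad (G i) d (A i *m d) - (d^T *m (G i *m B i *m (B i)^T *m G i) *m d) 0 0.
  by rewrite mulmxBl quadDr quadNr; congr (_ - _); rewrite /quad !mulmxA.
have -> : 2 * (quad (G i) d (A i *m d) -
      (d^T *m (G i *m B i *m (B i)^T *m G i) *m d) 0 0) =
    (d^T *m (G i *m A i + (A i)^T *m G i) *m d) 0 0 -
    2 * (d^T *m (G i *m B i *m (B i)^T *m G i) *m d) 0 0.
  rewrite mulrBr; congr (_ - _).
  rewrite mulmxDr mulmxDl mxE -qA mulr_natl mulr2n; congr (_ + _).
  by rewrite /quad !mulmxA.
rewrite lyap mulmxBr mulmxBl !mulmxA.
set a := d^T *m _ *m _ *m _ *m _ *m d; set b := _ *m d.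
rewrite mxE [(- b) _ _]mxE; ring.
Qed.

Section Trajectory.
Variable x : R -> stacked R N n.
Hypothesis hx : forall t : R, 0 < t -> is_derive t 1 x (F (x t)).

(** The Lyapunov function along the trajectory: the optimal value of the
    transport problem from the current state to the targets. *)
Definition lyapunov (t : R) : R := eot_value eps (C (x t)).

Lemma is_derive_block (t : R) i : 0 < t ->
  is_derive t 1 (fun s => block (x s) i)
    ((A i - B i *m (B i)^T *m G i) *m dev (x t) i).
Proof.
move=> t0; apply/is_derive_mxP => k j; rewrite (ord1 j).
under eq_fun do rewrite block_coord.
have /is_derive_mxP /(_ (tagnat.Rank i k) 0) := hx t0.
have <- : block (F (x t)) i = (A i - B i *m (B i)^T *m G i) *m dev (x t) i.
  by rewrite /block mxcolK.
by rewrite block_coord.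
Qed.

Lemma is_derive_ot_cost (t : R) i j : 0 < t ->
  is_derive t 1 (fun s => C (x s) i j)
    (2 * quad (G i) (block (x t) i - xd j)
       ((A i - B i *m (B i)^T *m G i) *m dev (x t) i)).
Proof.
move=> t0; under eq_fun do rewrite ot_costE.
set v := _ *m dev (x t) i.
have hy : is_derive t 1 (fun s => block (x s) i - xd j) v.
  by rewrite -[v]subr0; apply: is_deriveB; exact: is_derive_block.
have hG := is_derive_mulmx (is_derive_trmx hy) (is_derive_cst (G i) t 1).
have /is_derive_mxP /(_ 0 0) := is_derive_mulmx hG hy.
congr is_derive; rewrite /cst mulmx0 addr0 mxE -!/(quad _ _ _) quadC.
by rewrite mulr_natl.
Qed.

Lemma continuous_Pstar (t : R) i j : 0 < t -> {for t, continuous (fun s => P (x s) i j)}.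
Proof.
move=> t0; have [L [L0 hL]] := lipfun_Pstar i j.
have cx : {for t, continuous x} := is_derive_cont (hx t0).
apply/cvgrPdist_lt => e e0.
have d0 : 0 < e / (L + 1) by rewrite divr_gt0// ltr_wpDl.
have /cvgrPdist_lt /(_ _ d0) := cx; apply: filterS => s xs.
apply: (le_lt_trans (hL _ _)).
rewrite ltr_pdivlMr ?ltr_wpDl// in xs; apply: le_lt_trans xs.
by rewrite mulrC ler_wpM2l// lerDl.
Qed.

(** By the envelope theorem only the costs are differentiated; the weights P i j
    then average the x_i - xd_j into the deviation divided by N. *)
Lemma is_derive_lyapunov (t : R) : 0 < t ->
  is_derive t 1 lyapunov (- dissipation (x t)).
Proof.
move=> t0.
have := @is_derive_envelope R ('I_N * 'I_N)%type lyapunov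
  (fun ij s => C (x s) ij.1 ij.2) (fun ij s => P (x s) ij.1 ij.2)
  (fun ij => 2 * quad (G ij.1) (block (x t) ij.1 - xd ij.2)
       ((A ij.1 - B ij.1 *m (B ij.1)^T *m G ij.1) *m dev (x t) ij.1)) t.
move=> /(_ (fun ij => is_derive_ot_cost ij.1 ij.2 t0)).
move=> /(_ (fun ij => @continuous_Pstar t ij.1 ij.2 t0)).
have env s := eot_value_sub eps N0 (C (x t)) (C (x s)).
move=> H; have {H} := H.
have E (f : 'I_N * 'I_N -> R) : \sum_ij f ij = \sum_i \sum_j f (i, j).
  by rewrite pair_bigA; apply: eq_bigr => -[].
rewrite !E => H; have {H} := H.
have h1 s : \sum_ij (C (x s) ij.1 ij.2 - C (x t) ij.1 ij.2) * P (x s) ij.1 ij.2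
    <= lyapunov s - lyapunov t.
  by rewrite E; case/andP: (env s).
have h2 s : lyapunov s - lyapunov t <=
    \sum_ij (C (x s) ij.1 ij.2 - C (x t) ij.1 ij.2) * P (x t) ij.1 ij.2.
  by rewrite E; case/andP: (env s).
move=> /(_ h1 h2); congr is_derive; rewrite /=.
rewrite /dissipation -mulrN -sumrN mulr_sumr; apply: eq_bigr => i _.
set v := _ *m dev (x t) i.
rewrite -quad_closed_loop -/v.
have -> : N%:R^-1 * (2 * quad (G i) (dev (x t) i) v) =
    2 * quad (G i) (N%:R^-1 *: dev (x t) i) v by rewrite quadZl; ring.
have -> : N%:R^-1 *: dev (x t) i = \sum_j P (x t) i j *: (block (x t) i - xd j).
  under [RHS]eq_bigr do rewrite scalerBr.
  rewrite sumrB -scaler_suml (couplings_row i (couplings_Pstar _)) /deviation scalerBr scalerA.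
  by rewrite mulVf ?scale1r// pnatr_eq0 -lt0n.
rewrite quad_suml mulr_sumr; apply: eq_bigr => j _.
by rewrite quadZl; ring.
Qed.

Lemma lyapunov_nonincreasing (t : R) : 1 <= t -> lyapunov t <= lyapunov 1.
Proof.
rewrite le_eqVlt => /predU1P[<-//|t1].
have [u|u [/andP[u1 _] E]] := mean_value (f := lyapunov)
    (df := fun s => - dissipation (x s)) t1.
  by move=> /andP[u1 _]; apply: is_derive_lyapunov; apply: lt_le_trans u1.
by rewrite -subr_le0 E mulNr oppr_le0 mulr_ge0 ?dissipation_ge0// subr_ge0 ltW.
Qed.

(** The transport cost controls the size of the state, since each agent keeps
    mass 1 / N and the weighted norms are coercive. *)
Lemma bounded_trajectory : exists K, forall t, 1 <= t -> `|x t| <= K.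
Proof.
have /choice[c hc] := fun i => @invgram_coercive R n m Th (A i) (B i) Th0 (hctrl i).
pose K := lyapunov 1 + eps * N%:R ^+ 2.
have NR : 0 < N%:R :> R by rewrite ltr0n.
pose D i k := 2 * c i * K + 2 * \sum_j xd j k 0 ^+ 2.
have key t i k : 1 <= t -> block (x t) i k 0 ^+ 2 <= N%:R * D i k.
  move=> t1; have [c0 ci] := hc i.
  have [P0 _ _] := couplings_Pstar (x t).
  (* The total transport cost bounds the cost borne by agent i. *)
  have Pi : \sum_j C (x t) i j * P (x t) i j <= K.
    have h1 := eot_value_ge N0 eps0 (C (x t)); have h2 := lyapunov_nonincreasing t1.
    apply: (@le_trans _ _ (\sum_i \sum_j C (x t) i j * P (x t) i j)); last first.
      by rewrite /K -lerBlDr (le_trans h1).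
    rewrite [leRHS](bigD1 i)//= lerDl; apply: sumr_ge0 => i' _; apply: sumr_ge0 => j _.
    by rewrite mulr_ge0// ot_costE gram_psd.
  rewrite mulrC -ler_pdivrMr//.
  rewrite -(couplings_row i (couplings_Pstar (x t))) mulr_sumr.
  apply: (@le_trans _ _ (\sum_j (2 * c i * (C (x t) i j * P (x t) i j) +
     2 * xd j k 0 ^+ 2))); last first.
    rewrite big_split /= -!mulr_sumr lerD2r ler_wpM2l//.
    by rewrite mulr_ge0.
  apply: ler_sum => j _.
  have /andP[p0 p1] := couplings_itv N0 i j (couplings_Pstar (x t)).
  have := ci (block (x t) i - xd j) k; rewrite -/(G i) -/(quad _ _ _) -ot_costE.
  rewrite !mxE -block_coord; set a := block _ _ _ _; set b := xd _ _ _.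
  set q := wnorm _ _ ^+ 2; set p := P _ _ _ in p0 p1 *.
  move=> h; clearbody a b q p.
  have h1 : a ^+ 2 <= 2 * (c i * q) + 2 * b ^+ 2.
    have := sqr_ge0 (a - 2 * b); nra.
  have h2 : a ^+ 2 * p <= (2 * (c i * q) + 2 * b ^+ 2) * p by rewrite ler_wpM2r.
  have b2 := sqr_ge0 b; have : b ^+ 2 * p <= b ^+ 2 by rewrite ler_piMr.
  nra.
exists (1 + \sum_i \sum_k `|N%:R * D i k|) => t t1.
apply: norm_le_coord.
  by rewrite addr_ge0// sumr_ge0// => i _; apply: sumr_ge0.
move=> s; have := key t (tagnat.sig1 s) (tagnat.sig2 s) t1.
rewrite block_coord tagnat.sig2K; set a := x t _ _ => ha; clearbody a.
have : `|a| <= 1 + a ^+ 2.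
  by rewrite -[a ^+ 2]real_normK ?num_real//; have := sqr_ge0 (`|a| - 1); have := sqr_ge0 `|a|; nra.
move=> h; apply: (le_trans h); rewrite lerD2l; apply: (le_trans ha).
apply: (le_trans (ler_norm _)).
rewrite (bigD1 (tagnat.sig1 s))//= (bigD1 (tagnat.sig2 s))//= -addrA lerDl.
apply: addr_ge0; first by apply: sumr_ge0.
by apply: sumr_ge0 => i _; apply: sumr_ge0.
Qed.

Lemma liptime_trajectory s : liptime 1 (fun t => x t s 0).
Proof.
have [K hK] := bounded_trajectory.
have [M hM] := lipfun_bounded (lipfun_closed_loop s) hK.
apply: (@liptime_derive _ _ M _ (fun t => F (x t) s 0)) => [t t1|]; last exact: hM.
have t0 : 0 < t by exact: lt_le_trans t1.
by have /is_derive_mxP := hx t0; exact.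
Qed.

Lemma liptime_dissipation : liptime 1 (fun t => dissipation (x t)).
Proof.
have [K hK] := bounded_trajectory.
have sq p (M : 'M[R]_(p, n)) i l : liptime 1 (fun t => (M *m dev (x t) i) l 0 ^+ 2).
  have lM := lipfun_mul_deviation M i l.
  have [D hD] := lipfun_bounded lM hK.
  apply: (liptime_sqr hD); apply: liptime_comp lM _ => s.
  exact: liptime_trajectory.
apply: liptimeZ; apply: liptime_sum => i.
by apply: liptimeD; apply: liptime_sum => l; exact: sq.
Qed.

Lemma dissipation_vanishes (e : R) : 0 < e ->
  exists T, 1 <= T /\ forall t, T <= t -> dissipation (x t) < e.
Proof.
have [K hK] := liptime_dissipation.
apply: (@barbalat R lyapunov (fun t => dissipation (x t)) 1 (- (eps * N%:R ^+ 2)) K).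
- by move=> t t1; apply: is_derive_lyapunov; exact: lt_le_trans t1.
- by move=> t _; exact: dissipation_ge0.
- move=> t _; apply: le_trans (eot_value_ge N0 eps0 (C (x t))).
  rewrite lerBrDr addNr; apply: sumr_ge0 => i _; apply: sumr_ge0 => j _.
  rewrite ot_costE mulr_ge0 ?gram_psd//.
  by have [+ _ _] := couplings_Pstar (x t); apply.
- exact: hK.
Qed.

(** Both residuals defining Mset vanish asymptotically. *)
Lemma residual_vanishes i l (e : R) : 0 < e ->
  exists T, 1 <= T /\ forall t, T <= t ->
    `|((B i)^T *m G i *m dev (x t) i) l 0| < e /\
    `|((B i)^T *m expmx (- Th *: (A i)^T) *m G i *m dev (x t) i) l 0| < e.
Proof.
move=> e0; have NR : 0 < N%:R :> R by rewrite ltr0n.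
have [|T [T1 hT]] := @dissipation_vanishes (N%:R^-1 * e ^+ 2).
  by rewrite mulr_gt0 ?invr_gt0// exprn_gt0.
exists T; split=> // t /hT; rewrite ltr_pM2l ?invr_gt0// (bigD1 i)//=.
rewrite [X in X + _ + _](bigD1 l)//= [X in _ + X + _](bigD1 l)//=.
set a := (_ *m _) l 0; set b := (_ *m _) l 0.
set s1 := \sum_(j < _ | _) _; set s2 := \sum_(j < _ | _) _; set s3 := \sum_(j < _ | _) _.
have p1 : 0 <= s1 by apply: sumr_ge0 => *; exact: sqr_ge0.
have p2 : 0 <= s2 by apply: sumr_ge0 => *; exact: sqr_ge0.
have p3 : 0 <= s3.
  by apply: sumr_ge0 => *; apply: addr_ge0; apply: sumr_ge0 => *; exact: sqr_ge0.
clearbody a b s1 s2 s3; have a2 := sqr_ge0 a; have b2 := sqr_ge0 b.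
move=> h; split; rewrite -ltr_sqr ?nnegrE ?(ltW e0)// real_normK ?num_real//; lra.
Qed.

Lemma limit_set_Mset : limit_set x `<=` Mset Th eps A B xd.
Proof.
have vanish p (M : 'M[R]_(p, n)) i : (forall l (e : R), 0 < e ->
    exists T, forall t, T <= t -> `|(M *m dev (x t) i) l 0| < e) ->
    forall y, limit_set x y -> M *m dev y i = 0.
  move=> hM y yx; apply/matrixP => l j; rewrite (ord1 j) [RHS]mxE.
  have [L [L0 hL]] := lipfun_mul_deviation M i l.
  apply/eqP; rewrite -normr_le0; apply/ler_addgt0Pl => e e0; rewrite addr0.
  have e2 : 0 < e / 2 by rewrite divr_gt0.
  have [T hT] := hM l _ e2.
  have d0 : 0 < e / 2 / (L + 1) by rewrite divr_gt0// ltr_wpDl.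
  have [t [Tt xt]] := yx _ T d0.
  have h1 := hT t Tt; have h2 := hL (x t) y.
  have h3 : L * `|x t - y| <= e / 2.
    rewrite ltr_pdivlMr ?ltr_wpDl// in xt; apply: le_trans (ltW xt).
    by rewrite mulrC ler_wpM2l// lerDl.
  have tri (a b c : R) : `|a| < e / 2 -> `|a - b| <= c -> c <= e / 2 -> `|b| <= e.
    move=> ha hb hc; have -> : b = a - (a - b) by ring.
    by apply: (le_trans (ler_normB _ _)); lra.
  exact: tri h1 h2 h3.
move=> y yx i; split; apply: vanish yx => l e e0;
  by have [T [_ hT]] := residual_vanishes i l e0; exists T => t /hT[].
Qed.

(** The closed loop is an asymptotically vanishing perturbation of the drift. *)
Lemma closed_loop_drift (e : R) : 0 < e ->
  exists T, forall t, T <= t -> `|F (x t) - drift Th eps A B xd (x t)| <= e.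
Proof.
move=> e0.
have coord s : exists T, forall t, T <= t ->
    `|(F (x t) - drift Th eps A B xd (x t)) s 0| <= e.
  set i := tagnat.sig1 s; set k := tagnat.sig2 s.
  pose b := \sum_l `|B i k l| + 1.
  have b0 : 0 < b by rewrite ltr_wpDl// sumr_ge0.
  have eb : 0 < e / b by rewrite divr_gt0.
  have /choice[T hT] := fun l => residual_vanishes i l eb.
  exists (\sum_l T l) => t Tt.
  have -> : (F (x t) - drift Th eps A B xd (x t)) s 0 =
      - (B i *m ((B i)^T *m G i *m dev (x t) i)) k 0.
    have sub p (u v : 'cV[R]_p) l : (u - v) l 0 = u l 0 - v l 0 by rewrite !mxE.
    rewrite sub [closed_loop _ _ _ _ _ _ _ _]mxE [drift _ _ _ _ _ _ _ _]mxE -/i -/k.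
    by rewrite mulmxBl sub addrAC subrr add0r !mulmxA.
  rewrite normrN mxE; apply: (le_trans (ler_norm_sum _ _ _)).
  apply: (@le_trans _ _ ((\sum_l `|B i k l|) * (e / b))); last first.
    by rewrite mulrCA ler_piMr ?(ltW e0)// ler_pdivrMr// mul1r lerDl.
  rewrite mulr_suml; apply: ler_sum => l _; rewrite normrM ler_wpM2l//.
  apply: ltW; apply: ((hT l).2 t _).1; apply: le_trans Tt.
  rewrite (bigD1 l)//= lerDl; apply: sumr_ge0 => l' _.
  by apply: le_trans (hT l').1.
have /choice[T hT] := coord.
exists (\sum_s `|T s|) => t Tt; apply: norm_le_coord; first exact: ltW.
move=> s; apply: hT; apply: le_trans Tt; apply: (le_trans (ler_norm _)).
by rewrite (bigD1 s)//= lerDl sumr_ge0.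
Qed.

Lemma closed_loop_converges :
  converges_to_set x (largest_invariant (drift Th eps A B xd) (Mset Th eps A B xd)).
Proof.
have [L [L0 hL]] := lipfun_norm lipfun_drift.
apply: (@converges_to_largest_invariant R _ (drift Th eps A B xd) L L0 hL x
  (fun t => F (x t)) 1).
- by move=> t t1; apply: hx; exact: lt_le_trans t1.
- exact: closed_loop_drift.
- exact: bounded_trajectory.
- exact: limit_set_Mset.
Qed.

End Trajectory.

End ClosedLoop.

Unset Implicit Arguments.

Theorem theorem1 (R : realType) (N n m : nat)
    (hN : (0 < N)%N) (hn : (0 < n)%N) (hm : (0 < m)%N)
    (Th : R) (hTh : 0 < Th) (eps : R) (heps : 0 < eps)
    (A : 'I_N -> 'M[R]_n) (B : 'I_N -> 'M[R]_(n, m))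
    (xd : 'I_N -> 'cV[R]_n)
    (hctrl : forall i : 'I_N, controllable (A i) (B i))
    (heq : forall i j : 'I_N,
       exists u : 'cV[R]_m, A i *m xd j + B i *m u = 0)
    (x0 : stacked R N n) (x : R -> stacked R N n)
    (hx0 : x 0 = x0)
    (hx : forward_solution (closed_loop Th eps A B xd) x) :
  converges_to_set x
    (largest_invariant (drift Th eps A B xd) (Mset Th eps A B xd)).
Proof.
have [_ dx] := hx.
exact: (closed_loop_converges hN hTh heps hctrl dx).
Qed.
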